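(* Let $\varepsilon>0$. For every fixed $t\in(0,T]$, $$S_{N,t}(u_\varepsilon)\xrightarrow[N\to\infty]{L^1(\Omega)}\frac12(A_2-A_1)\,\varepsilon^{-1}.$$
   Context: Fix $T>0$. $\mathbb{T}=\mathbb{R}/\mathbb{Z}$ is the one-dimensional flat torus, identified with $[0,1)$ with periodic boundary conditions. $p_t(x)=\sum_{k\in\mathbb{Z}}\frac{1}{\sqrt{4\pi t}}e^{-(x-k)^2/(4t)}$ is the periodic heat kernel. $W$ is a space-time Gaussian white noise on $[0,T]\times\mathbb{T}$, i.e. a centered Gaussian family with $\mathbf{E}[W(A)W(B)]=\lambda(A\cap B)$ for Borel $A,B\subset[0,T]\times\mathbb{T}$, $\lambda$ being Lebesgue measure. Let $f(u)=u-u^3$. For $\varepsilon>0$, $u_\varepsilon$ is the unique mild solution, with zero initial condition, of the stochastic Allen--Cahn equation $\partial_tu_\varepsilon=\varepsilon\,\partial_x^2u_\varepsilon+f(u_\varepsilon)+\dot W$ on $[0,T]\times\mathbb{T}$, i.e. $$u_\varepsilon(t,x)=\int_0^t\!\int_{\mathbb{T}}p_{\varepsilon(t-s)}(x-y)f(u_\varepsilon(s,y))\,dy\,ds+\int_0^t\!\int_{\mathbb{T}}p_{\varepsilon(t-s)}(x-y)\,W(ds,dy);$$ it satisfies $\sup_{t\in[0,T],x\in\mathbb{T}}\mathbf{E}|u_\varepsilon(t,x)|^q<\infty$ for all $q\ge2$. Let $A_1<A_2$ with $[A_1,A_2]\subset\mathbb{T}$, and for $N\ge1$ let $x_i=A_1+i\frac{A_2-A_1}{N}$,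 $i=0,\dots,N$. The spatial quadratic variation of a random field $Z$ at time $t$ is $$S_{N,t}(Z)=\sum_{i=0}^{N-1}\bigl(Z(t,x_{i+1})-Z(t,x_i)\bigr)^2 .$$ *)

(* Defs.v *)
From HB Require Import structures.
From mathcomp Require Import all_boot all_order all_algebra.
From mathcomp Require Import all_classical all_reals all_analysis.

Set Implicit Arguments.
Unset Strict Implicit.
Unset Printing Implicit Defensive.

Import Order.TTheory GRing.Theory Num.Theory.
Import numFieldNormedType.Exports.

Local Open Scope classical_set_scope.
Local Open Scope ring_scope.

(* The torus R/Z is represented by [0, 1[, so [0, T] x R/Z is a Borel subset of
   R x R. *)
Definition spacetime {R : realType} (T : R) : set (R * R) :=
  `[0, T]%classic `*` `[0, 1[%classic.

Definition lebesgue2 {R : realType} :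
    {measure set (measurableTypeR R * measurableTypeR R) -> \bar R} :=
  (lebesgue_measure \x lebesgue_measure)%E.

Definition cvgLp d (S : measurableType d) (R : realType)
    (mu : {measure set S -> \bar R}) (p : R) (X : nat -> S -> R) (Y : S -> R) :=
  [/\ forall n, X n \in Lfun mu p%:E,
      Y \in Lfun mu p%:E &
      ('N[mu]_(p%:E)[EFin \o (X n \- Y)%R])%E @[n --> \oo] --> 0%E].

(* The library's normal_prob m s is meant for s != 0 only: the degenerate
   centered Gaussian law is treated apart. *)
Definition centered_gaussian d (Omega : measurableType d) (R : realType)
    (P : probability Omega R) (X : Omega -> R) :=
  measurable_fun setT X /\
  ({ae P, forall w, X w = 0} \/
   exists2 s : R, s != 0 &
     forall B : set R, measurable B -> P (X @^-1` B) = normal_prob 0 s B).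

(* A list of pairs (c, A) encodes the step function \sum c 1_A; sum_noise is
   its integral against W. *)
Definition admissible {R : realType} (T : R) (s : seq (R * set (R * R))) :=
  forall p, p \in s -> measurable p.2 /\ p.2 `<=` spacetime T.

Definition sum_indic {R : realType} (s : seq (R * set (R * R))) (z : R * R) : R :=
  \sum_(p <- s) p.1 * \1_(p.2) z.

Definition sum_noise {R : realType} {Omega : Type}
    (W : set (R * R) -> Omega -> R) (s : seq (R * set (R * R))) (w : Omega) : R :=
  \sum_(p <- s) p.1 * W p.2 w.

Definition white_noise d (Omega : measurableType d) (R : realType)
    (P : probability Omega R) (T : R) (W : set (R * R) -> Omega -> R) :=
  (forall s, admissible T s -> centered_gaussian P (sum_noise W s)) /\
  (forall A B : set (R * R),
     measurable A -> A `<=` spacetime T ->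
     measurable B -> B `<=` spacetime T ->
     ('E_P[(W A \* W B)%R])%E = lebesgue2 (A `&` B)).

(* X is a version of the Wiener integral of h over [0, T] x R/Z: the L^2(P)
   limit of the integrals of step functions converging to h in L^2. *)
Definition wiener_integral d (Omega : measurableType d) (R : realType)
    (P : probability Omega R) (T : R) (W : set (R * R) -> Omega -> R)
    (h : R * R -> R) (X : Omega -> R) :=
  exists s : nat -> seq (R * set (R * R)),
    [/\ forall n, admissible T (s n),
        cvgLp lebesgue2 2 (fun n => sum_indic (s n)) (h \_ (spacetime T)) &
        cvgLp P 2 (fun n => sum_noise W (s n)) X].

Definition heat_kernel {R : realType} (t x : R) : R :=
  fine (\esum_(k in [set: int])
    ((Num.sqrt (4 * pi * t))^-1 * expR (- (x - k%:~R) ^+ 2 / (4 * t)))%:E).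

Definition allen_cahn {R : realType} (v : R) : R := v - v ^+ 3.

Definition mild_solution d (Omega : measurableType d) (R : realType)
    (P : probability Omega R) (T eps : R) (W : set (R * R) -> Omega -> R)
    (u : R -> R -> Omega -> R) :=
  measurable_fun (spacetime T `*` [set: Omega])
    (fun z : (R * R) * Omega => u z.1.1 z.1.2 z.2) /\
  forall t x, spacetime T (t, x) ->
    exists2 Z : Omega -> R,
      wiener_integral P T W
        (fun z => \1_(`[0, t]) z.1 * heat_kernel (eps * (t - z.1)) (x - z.2)) Z &
      {ae P, forall w, u t x w =
        (\int[lebesgue_measure]_(s in `[0, t])
           (\int[lebesgue_measure]_(y in `[0, 1[)
              (heat_kernel (eps * (t - s)) (x - y) * allen_cahn (u s y w))))
        + Z w}.

Definition bounded_moments d (Omega : measurableType d) (R : realType)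
    (P : probability Omega R) (T : R) (u : R -> R -> Omega -> R) :=
  forall q : R, 2 <= q ->
    (ereal_sup [set 'E_P[(fun w => `|u z.1 z.2 w| `^ q)%R] | z in spacetime T]
      < +oo)%E.

Definition spatial_qv {R : realType} {Omega : Type} (A1 A2 : R) (N : nat) (t : R)
    (Z : R -> R -> Omega -> R) (w : Omega) : R :=
  let x i := A1 + i%:R * ((A2 - A1) / N%:R) in
  \sum_(0 <= i < N) (Z t (x i.+1) w - Z t (x i) w) ^+ 2.

(* Main.v *)
Require Import Defs.
From HB Require Import structures.
From mathcomp Require Import all_boot all_order all_algebra.
From mathcomp Require Import all_classical all_reals all_analysis.
From mathcomp Require Import measurable_realfun.
From mathcomp Require Import ring lra zify.

(** By the mild formulation, u (t, x) is almost surely the sum of a drift term and of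
    the Wiener integral Z x of the heat kernel (the stochastic convolution). The
    drift is negligible for the quadratic variation because it is Lipschitz in x,
    and the quadratic variation of the Gaussian field Z is computed from its
    covariance.

    Drift. The heat kernel satisfies
      |p_s (x) - p_s (x')| <= C |x - x'| s^(-1/2) (p_(2s) (x) + p_(2s) (x'))
    (heat_kernel_dist_le), and s^(-1/2) is integrable near 0; with the moment
    bounds on u this makes x |-> drift x Lipschitz in L^2 (drift_increment).
    Over a grid of mesh h the squares of its increments add up to O(h).

    Covariance. By the isometry and the semigroup property
    (ip_conv_kernel), E (Z x * Z x') is the integral over [0, t] of
    p_(2 eps (t - s)) (x - x') ds. For the kernel g of the line, in place of p,
    this integral is explicit: (2 eps)^(-1) (excess z - z^+), where excess z is
    the expectation of the positive part of a Gaussian variable centered at z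
    with variance 4 eps t (integral_gaussk_time). The function excess is smooth,
    whereas z^+ has a kink at 0. Hence the covariance of two increments of
    Z over the grid is (2 eps)^(-1) (h 1_(i = j) - O(h^2))
    (heat_cov_diff2, ip_conv_kernel_increment): the variances add up to
    (A2 - A1) / (2 eps) + O(h), and the squared covariances to O(h)
    (increment_cov_sums).

    Concentration. For jointly Gaussian centered variables, the variance of
    a sum of squares is twice the sum of the squared covariances
    (wick_variance). This is proved for integrals of step functions, for which
    joint Gaussianity is given, and passed to the limit (wiener_qv_bound).

    The L^1 estimates rest on 2 |Y| <= eta + Y^2 / eta and
    |x^2 - y^2| <= eta y^2 + (1 + 1 / eta) (x - y)^2 with a free parameter eta;
    they leave an error eta * O(1) + h * O(1 / eta), which tends to 0
    (qv_bound, cvg0_of_tradeoff). *)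

Set Implicit Arguments.
Unset Strict Implicit.
Unset Printing Implicit Defensive.

Import Order.TTheory GRing.Theory Num.Theory.
Import numFieldNormedType.Exports.

Local Open Scope classical_set_scope.
Local Open Scope ring_scope.

(** * The Gaussian kernel and its time integral *)

Section gaussian_kernel.
Context {R : realType}.
Notation mu := (@lebesgue_measure R).
Implicit Types s x y h : R.

Definition ncdf s x : R := \int[mu]_(v in `]-oo, x]) normal_pdf 0 s v.

Lemma normal_pdf0E s : s != 0 ->
  normal_pdf 0 s = fun x => normal_peak s * expR (- (x ^+ 2 / (s ^+ 2 *+ 2))).
Proof.
by move=> s0; rewrite normal_pdfE//; apply/funext => x; rewrite /normal_fun subr0 mulNr.
Qed.

Lemma is_derive_normal_pdf s x : s != 0 ->
  is_derive x 1 (normal_pdf 0 s) (- x / s ^+ 2 * normal_pdf 0 s x).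
Proof.
move=> s0; rewrite normal_pdf0E//.
apply: is_derive_eq; rewrite /GRing.scale/=.
have : s ^+ 2 != 0 by rewrite expf_neq0.
by move: (s ^+ 2) => s2 s20; field.
Qed.

Lemma is_derive_ncdf s x : s != 0 -> is_derive x 1 (ncdf s) (normal_pdf 0 s x).
Proof.
move=> s0.
have [] := @continuous_FTC1 R (normal_pdf 0 s) -oo%O x (x + 1).
- by rewrite ltrDl.
- by apply: integrableS (integrable_normal_pdf 0 s).
- by rewrite ltNyr.
- exact: continuous_normal_pdf.
by move=> dF <-; rewrite derive1E; exact: derivableP.
Qed.

Lemma ncdf_cdf s x : (ncdf s x)%:E = normal_prob 0 s `]-oo, x].
Proof.
rewrite /ncdf /Rintegral fineK//; apply: integrable_fin_num => //.
by apply: integrableS (integrable_normal_pdf 0 s).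
Qed.

Lemma ncdf_y s : ncdf s x @[x --> +oo%R] --> (1:R).
Proof.
pose X : {mfun measurableTypeR R >-> R} := HB.pack
  (idfun : measurableTypeR R -> R)
  (@isMeasurableFun.Build _ _ (measurableTypeR R) R idfun
    (@measurable_id _ _ setT)).
have := @cvg_cdfy1 _ _ R (normal_prob 0 s) X.
rewrite [X in X @ _ --> _](_ : _ = EFin \o ncdf s); last first.
  by apply/funext => x /=; rewrite ncdf_cdf.
by move=> /fine_cvgP[].
Qed.

Lemma ncdf_Ny s : ncdf s x @[x --> -oo%R] --> (0:R).
Proof.
pose X : {mfun measurableTypeR R >-> R} := HB.pack
  (idfun : measurableTypeR R -> R)
  (@isMeasurableFun.Build _ _ (measurableTypeR R) R idfun
    (@measurable_id _ _ setT)).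
have := @cvg_cdfNy0 _ _ R (normal_prob 0 s) X.
rewrite [X in X @ _ --> _](_ : _ = EFin \o ncdf s); last first.
  by apply/funext => x /=; rewrite ncdf_cdf.
by move=> /fine_cvgP[].
Qed.


Definition gaussk (s x : R) : R :=
  (Num.sqrt (4 * pi * s))^-1 * expR (- x ^+ 2 / (4 * s)).

Lemma gaussk_ge0 s x : 0 <= gaussk s x.
Proof. by rewrite mulr_ge0 ?expR_ge0 ?invr_ge0. Qed.

Lemma gausskN s x : gaussk s (- x) = gaussk s x.
Proof. by rewrite /gaussk sqrrN. Qed.

Lemma gaussk_pdf s x : 0 < s -> gaussk s x = normal_pdf 0 (Num.sqrt (2 * s)) x.
Proof.
move=> s0; have s20 : 0 < 2 * s by rewrite mulr_gt0.
rewrite normal_pdf0E ?gt_eqF ?sqrtr_gt0// /normal_peak sqr_sqrtr ?ltW//.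
rewrite /gaussk; congr ((Num.sqrt _)^-1 * expR _); first by rewrite mulr2n; ring.
by rewrite mulNr; congr (- (_ * _^-1)); rewrite mulr2n; ring.
Qed.

Lemma gaussk_std s x : 0 < s ->
  gaussk s x = (Num.sqrt (2 * s))^-1 * normal_pdf 0 1 (x / Num.sqrt (2 * s)).
Proof.
move=> s0; have s20 : 0 < 2 * s by rewrite mulr_gt0.
rewrite normal_pdf0E ?oner_eq0// /normal_peak expr1n mul1r mulrA -invfM.
rewrite /gaussk expr_div_n sqr_sqrtr ?(ltW s20)// -sqrtrM ?ltW//.
congr ((Num.sqrt _)^-1 * expR _); first by rewrite mulr2n; ring.
by rewrite mulNr; congr (- _); field; exact: lt0r_neq0.
Qed.

(** The expectation of the positive part of y + G, G a standard normal variable. *)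
Definition std_excess (y : R) := y * ncdf 1 y + normal_pdf 0 1 y.

Lemma is_derive_std_excess y : is_derive y 1 std_excess (ncdf 1 y).
Proof.
have ? := @is_derive_normal_pdf 1 y (oner_neq0 R).
have ? := @is_derive_ncdf 1 y (oner_neq0 R).
apply: is_derive_eq; rewrite /GRing.scale/= expr1n divr1; ring.
Qed.

(** The expectation of the positive part of x + sqrt (2 s) G: the solution of the
    heat equation with initial value the positive part of x. *)
Definition excess s x : R := Num.sqrt (2 * s) * std_excess (x / Num.sqrt (2 * s)).

(** The heat equation for [excess], whose second space derivative is the Gaussian
    kernel ([is_derive_excess_space], [is_derive_ncdf_scaled]). So
    [excess] is the primitive that integrates the kernel in time. *)
Lemma is_derive_excess_time s x : 0 < s -> is_derive s 1 (excess^~ x) (gaussk s x).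
Proof.
move=> s0; have s20 : 0 < 2 * s by rewrite mulr_gt0.
have q0 : 0 < Num.sqrt (2 * s) by rewrite sqrtr_gt0.
have d1 : is_derive s 1 (fun r : R => Num.sqrt (2 * r)) (Num.sqrt (2 * s))^-1.
  have ? := @is_derive1_sqrt R (2 * s) s20.
  have d0 : is_derive s 1 (fun r : R => 2 * r) 2.
    by apply: is_derive_eq; rewrite /GRing.scale/=; ring.
  have := @is_derive1_comp R (@Num.sqrt R) (fun r => 2 * r) s _ _
    (is_derive1_sqrt s20) d0.
  move/is_derive_eq; apply.
  by field; exact: lt0r_neq0.
have d2 : is_derive s 1 (fun r : R => (Num.sqrt (2 * r))^-1)
    (- (Num.sqrt (2 * s)) ^- 2 * (Num.sqrt (2 * s))^-1).
  by apply: is_deriveV; rewrite gt_eqF.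
have d3 : is_derive s 1 (fun r : R => x * (Num.sqrt (2 * r))^-1)
    (x * (- (Num.sqrt (2 * s)) ^- 2 * (Num.sqrt (2 * s))^-1)).
  by apply: is_derive_eq; rewrite /GRing.scale/=; ring.
have d4 := is_derive_std_excess (x / Num.sqrt (2 * s)).
have d5 := @is_derive1_comp R std_excess (fun r => x * (Num.sqrt (2 * r))^-1) s _ _ d4 d3.
have := @is_deriveM R _ (fun r : R => Num.sqrt (2 * r)) _ s 1 _ _ d1 d5.
move/is_derive_eq; apply.
rewrite gaussk_std// /std_excess /GRing.scale/=; field; exact: lt0r_neq0.
Qed.

Lemma is_derive_excess_space s x : 0 < s ->
  is_derive x 1 (excess s) (ncdf 1 (x / Num.sqrt (2 * s))).
Proof.
move=> s0; have s20 : 0 < 2 * s by rewrite mulr_gt0.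
have q0 : 0 < Num.sqrt (2 * s) by rewrite sqrtr_gt0.
have d4 := is_derive_std_excess (x / Num.sqrt (2 * s)).
have d3 : is_derive x 1 (fun r : R => r / Num.sqrt (2 * s)) (Num.sqrt (2 * s))^-1.
  by apply: is_derive_eq; rewrite /GRing.scale/=; ring.
have d5 := @is_derive1_comp R std_excess (fun r => r / (Num.sqrt (2 * s))) x _ _ d4 d3.
by apply: is_derive_eq; rewrite /GRing.scale/=; field; exact: lt0r_neq0.
Qed.

Lemma is_derive_ncdf_scaled s x : 0 < s ->
  is_derive x 1 (fun y => ncdf 1 (y / Num.sqrt (2 * s))) (gaussk s x).
Proof.
move=> s0; have s20 : 0 < 2 * s by rewrite mulr_gt0.
have q0 : 0 < Num.sqrt (2 * s) by rewrite sqrtr_gt0.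
have d4 := @is_derive_ncdf 1 (x / Num.sqrt (2 * s)) (oner_neq0 R).
have d3 : is_derive x 1 (fun r : R => r / Num.sqrt (2 * s)) (Num.sqrt (2 * s))^-1.
  by apply: is_derive_eq; rewrite /GRing.scale/=; ring.
have d5 := @is_derive1_comp R (ncdf 1) (fun r => r / (Num.sqrt (2 * s))) x _ _ d4 d3.
by move/is_derive_eq: d5; apply; rewrite gaussk_std// mulrC.
Qed.

Lemma is_derive_continuous (f df : R -> R) (D : set R) :
  (forall x, is_derive x 1 f (df x)) -> {within D, continuous f}.
Proof.
move=> H; apply: continuous_subspaceT => x.
by apply/differentiable_continuous/derivable1_diffP; case: (H x).
Qed.

(** The second space derivative of [excess s] is [gaussk s], so its second
    differences have the order of h^2. *)
Lemma excess_diff2 s x h M : 0 < s -> 0 <= h ->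
  (forall y, x - h <= y <= x + h -> gaussk s y <= M) ->
  0 <= excess s (x + h) + excess s (x - h) - 2 * excess s x <= 2 * M * h ^+ 2.
Proof.
move=> s0 h0 hM.
pose N y := ncdf 1 (y / Num.sqrt (2 * s)).
have cpsi D : {within D, continuous (excess s)}.
  by apply: is_derive_continuous => y; exact: is_derive_excess_space.
have cN D : {within D, continuous N}.
  by apply: is_derive_continuous => y; exact: is_derive_ncdf_scaled.
(* The mean value theorem on both sides of x, then for the derivative between
   the two intermediate points: the second difference is h (c1 - c2) gaussk s c. *)
have [||c1 /[!in_itv]/= /andP[c1l c1u] e1] :=
  @MVT_segment R (excess s) N x (x + h) _ _ (cpsi _).
- by rewrite lerDl.
- by move=> y _; exact: is_derive_excess_space.
have [||c2 /[!in_itv]/= /andP[c2l c2u] e2] :=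
  @MVT_segment R (excess s) N (x - h) x _ _ (cpsi _).
- by rewrite lerBlDr lerDl.
- by move=> y _; exact: is_derive_excess_space.
have [||c /[!in_itv]/= /andP[cl cu] e] :=
  @MVT_segment R N (gaussk s) c2 c1 _ _ (cN _).
- exact: le_trans c1l.
- by move=> y _; exact: is_derive_ncdf_scaled.
have -> : excess s (x + h) + excess s (x - h) - 2 * excess s x = h * (gaussk s c * (c1 - c2)).
  rewrite -e.
  have := e1; rewrite -(addrC h) addrK => e1'.
  have := e2; rewrite opprB addrCA subrr addr0 => e2'.
  by rewrite mulrBr [h * _]mulrC -e1' [h * _]mulrC -e2'; ring.
have g0 := gaussk_ge0 s c.
have gM : gaussk s c <= M by apply: hM; apply/andP; split; lra.
have c120 : 0 <= c1 - c2 by lra.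
apply/andP; split; first by rewrite !mulr_ge0.
have : gaussk s c * (c1 - c2) <= M * (2 * h) by apply: ler_pM => //; lra.
move=> /(ler_wpM2l h0) /le_trans; apply.
by rewrite le_eqVlt; apply/orP; left; apply/eqP; ring.
Qed.

End gaussian_kernel.

Section gaussian_integrals.
Context {R : realType}.
Notation mu := (@lebesgue_measure R).
Implicit Types s x y h : R.

(** At s = 0 the variable x + sqrt (2 s) G degenerates to x. *)
Lemma cvg_excess0 (u : R^nat) z : (forall n, 0 < u n) -> u n @[n --> \oo] --> 0 ->
  excess (u n) z @[n --> \oo] --> Num.max z 0.
Proof.
move=> u0 ul.
have q0 n : 0 < Num.sqrt (2 * u n) by rewrite sqrtr_gt0 mulr_gt0.
have ql : Num.sqrt (2 * u n) @[n --> \oo] --> 0.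
  rewrite -(@sqrtr0 R); apply: continuous_cvg; first exact: sqrt_continuous.
  by rewrite -(mulr0 2); apply: cvgM ul; exact: cvg_cst.
have qy : (Num.sqrt (2 * u n))^-1 @[n --> \oo] --> +oo%R.
  by apply/cvgrVy => //; exact: nearW.
have pdfl : Num.sqrt (2 * u n) * normal_pdf 0 1 (z / Num.sqrt (2 * u n))
    @[n --> \oo] --> (0:R).
  apply: (@squeeze_cvgr _ _ _ _ (cst 0) (fun n => Num.sqrt (2 * u n) * normal_peak 1)).
  - apply: nearW => n /=; apply/andP; split.
      by rewrite mulr_ge0 ?normal_pdf_ge0 ?ltW.
    by rewrite ler_pM2l//; exact: normal_pdf_ub (oner_neq0 _).
  - exact: cvg_cst.
  - by rewrite -(mul0r (normal_peak 1)); apply: cvgM ql _; exact: cvg_cst.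
have cdfl : z * ncdf 1 (z / Num.sqrt (2 * u n)) @[n --> \oo] --> Num.max z 0.
  have [z0|z0|->] := ltgtP z 0.
  - rewrite -[X in _ --> X](mulr0 z); apply: cvgM; first exact: cvg_cst.
    apply: (cvg_comp (fun n => z / Num.sqrt (2 * u n)) (ncdf 1) _ (ncdf_Ny 1)).
    have : ((- z) * (Num.sqrt (2 * u n))^-1) @[n --> \oo] --> +oo%R.
      apply: (cvg_comp _ (fun y => - z * y) qy); apply: gt0_cvgMry (@cvg_id _ _).
      by rewrite oppr_gt0.
    by under eq_fun do rewrite mulNr; move/cvgNry.
  - rewrite -[X in _ --> X](mulr1 z); apply: cvgM; first exact: cvg_cst.
    apply: (cvg_comp (fun n => z / Num.sqrt (2 * u n)) (ncdf 1) _ (ncdf_y 1)).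
    exact: (cvg_comp _ (fun y => z * y) qy (gt0_cvgMry z0 (@cvg_id _ _))).
  - under eq_fun do rewrite mul0r; exact: cvg_cst.
rewrite -[X in _ --> X]addr0.
rewrite (_ : (fun n => excess (u n) z) = (fun n => z * ncdf 1 (z / Num.sqrt (2 * u n))) \+
  (fun n => Num.sqrt (2 * u n) * normal_pdf 0 1 (z / Num.sqrt (2 * u n)))).
  exact: (cvgD cdfl pdfl).
apply/funext => n /=; rewrite /excess /std_excess mulrDr mulrA; congr (_ * _ + _).
by rewrite mulrC divfK// gt_eqF.
Qed.


Lemma continuous_gaussk_time s x : 0 < s -> {for s, continuous (gaussk^~ x)}.
Proof.
move=> s0.
have lin (c : R) : (c * v)%R @[v --> s] --> c * s.
  by apply: cvgM; [exact: cvg_cst|exact: cvg_id].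
apply: cvgM.
  apply: cvgV; first by rewrite gt_eqF// sqrtr_gt0 !mulr_gt0// pi_gt0.
  by apply: continuous_cvg; [exact: sqrt_continuous|exact: lin].
apply: continuous_cvg; first exact: continuous_expR.
apply: cvgM; first exact: cvg_cst.
by apply: cvgV; [rewrite gt_eqF// mulr_gt0|exact: lin].
Qed.

Lemma integral_gaussk s : 0 < s -> (\int[mu]_x (gaussk s x)%:E = 1)%E.
Proof.
move=> s0; under eq_integral do rewrite gaussk_pdf//.
exact: integral_normal_pdf.
Qed.

(** Square roots and inverses are expressed by exp and ln; the kernel vanishes
    for s <= 0. *)
Lemma measurable_gaussk_pair : measurable_fun [set: R * R] (fun p => gaussk p.1 p.2).
Proof.
have -> : (fun p : R * R => gaussk p.1 p.2) = fun p =>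
   if p.1 <= 0 then 0 else
   expR (- (2^-1 * ln (4 * pi * p.1))) * expR (- (p.2 ^+ 2 * expR (- ln (4 * p.1)))).
  apply/funext => -[a b] /=; rewrite /gaussk; have [a0|a0] := leP a 0.
    by rewrite ler0_sqrtr ?invr0 ?mul0r// mulr_ge0_le0// mulr_ge0// pi_ge0.
  have c0 : 0 < 4 * pi * a by rewrite !mulr_gt0// pi_gt0.
  rewrite [expR (- ln _)]expRN lnK ?posrE ?mulr_gt0// mulNr; congr (_ * _).
  by rewrite expRN -powR12_sqrt ?(ltW c0)// /powR gt_eqF.
apply: measurable_fun_ifT.
- by apply: measurable_fun_ler.
- by [].
- apply: measurable_funM.
    apply: measurableT_comp => //; apply: measurableT_comp => //.
    apply: measurable_funM => //; apply: measurableT_comp; first exact: measurable_ln.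
    exact: measurable_funM.
  apply: measurableT_comp => //; apply: measurableT_comp => //.
  apply: measurable_funM; first exact: measurable_funX.
  apply: measurableT_comp => //; apply: measurableT_comp => //.
  by apply: measurableT_comp; [exact: measurable_ln|exact: measurable_funM].
Qed.

Lemma measurable_gaussk d (T : measurableType d) (f g : T -> R) :
  measurable_fun setT f -> measurable_fun setT g ->
  measurable_fun setT (fun z => gaussk (f z) (g z)).
Proof.
by move=> mf mg; exact: (measurableT_comp measurable_gaussk_pair (measurable_fun_pair mf mg)).
Qed.

(** The source of the limiting constant: of the two terms, [excess] is smooth in z
    and the positive part of z has a kink at 0. *)
Lemma integral_gaussk_time (a t z : R) : 0 < a -> 0 < t ->
  (\int[mu]_(s in `[0%R, t]) (gaussk (a * (t - s)) z)%:E =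
   ((excess (a * t) z - Num.max z 0) / a)%:E)%E.
Proof.
move=> a0 t0.
(* The primitive is differentiable only for s < t, hence the exhaustion of [0, t[
   by intervals [0, r n]. *)
pose r n : R := t - t / n.+2%:R.
have r0 n : 0 < r n.
  by rewrite subr_gt0 ltr_pdivrMr// -[ltLHS]mulr1 ltr_pM2l// ltr1n.
have rt n : r n < t by rewrite ltrBlDr ltrDl divr_gt0.
have rint n : (\int[mu]_(s in `[0%R, r n]) (gaussk (a * (t - s)) z)%:E =
    ((excess (a * t) z - excess (a * (t - r n)) z) / a)%:E)%E.
  have dF s : s < t -> is_derive s 1 (fun s => - (excess (a * (t - s)) z / a))
      (gaussk (a * (t - s)) z).
    move=> st; have ats : 0 < a * (t - s) by rewrite mulr_gt0// subr_gt0.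
    have d0 : is_derive s 1 (fun s : R => a * (t - s)) (- a).
      by apply: is_derive_eq; rewrite /GRing.scale/=; ring.
    have d1 := @is_derive1_comp R (excess^~ z) (fun s => a * (t - s)) s _ _
      (is_derive_excess_time z ats) d0.
    have d2 : is_derive s 1 (fun s => excess (a * (t - s)) z)
      (gaussk (a * (t - s)) z * - a) by exact: d1.
    apply: is_derive_eq; rewrite /GRing.scale/=; field; exact: lt0r_neq0.
  have cF s : s < t -> {for s, continuous (fun s => - (excess (a * (t - s)) z / a))}.
    by move=> /dF[dFs _]; apply/differentiable_continuous/derivable1_diffP.
  rewrite (@continuous_FTC2 R _ (fun s => - (excess (a * (t - s)) z / a))) //.
  - rewrite subr0 -EFinB; congr (_%:E); ring.
  - apply: continuous_in_subspaceT => s; rewrite inE/= in_itv/= => /andP[_ sr].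
    have ats : 0 < a * (t - s) by rewrite mulr_gt0// subr_gt0 (le_lt_trans sr).
    apply: (@continuous_comp _ _ _ (fun s : R => a * (t - s)) (gaussk^~ z)).
      apply: cvgM; first exact: cvg_cst.
      by apply: cvgB; [exact: cvg_cst|exact: cvg_id].
    exact: continuous_gaussk_time.
  - split.
    + by move=> s; rewrite in_itv/= => /andP[_ sr]; case: (dF s (lt_trans sr (rt n))).
    + by apply: cvg_at_right_filter; exact: cF.
    + by apply: cvg_at_left_filter; exact: cF.
  - move=> s; rewrite in_itv/= => /andP[_ sr].
    by rewrite derive1E; have [_ ->] := dF s (lt_trans sr (rt n)).
have rl : t / n.+2%:R @[n --> \oo] --> (0:R).
  rewrite -(mulr0 t); apply: cvgM; first exact: cvg_cst.
  by have := @cvg_harmonic R; rewrite -cvg_shiftS.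
have bigU : \bigcup_n `[0%R, r n]%classic = `[0%R, t[%classic.
  apply/seteqP; split => s /=; rewrite ?in_itv/=.
    move=> [n _] /=; rewrite in_itv/= => /andP[-> sr]/=.
    exact: le_lt_trans (rt n).
  move=> /andP[s0 st].
  have : \forall n \near \oo, t / n.+2%:R < t - s.
    by apply: (cvgr_lt 0) rl _ _; rewrite subr_gt0.
  move=> [N _ /(_ N (leqnn N)) /= hN]; exists N => //=.
  by rewrite in_itv/= s0/= /r; move: (t / _) hN => q hN; lra.
have mg D : measurable_fun D (fun s : R => (gaussk (a * (t - s)) z)%:E).
  apply/measurable_funTS/measurable_EFinP/measurable_gaussk => //.
  by apply: measurable_funM => //; exact: measurable_funB.
have cvg1 : (\int[mu]_(s in `[0%R, r n]) (gaussk (a * (t - s)) z)%:E)%E @[n --> \oo] -->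
    (\int[mu]_(s in \bigcup_n `[0%R, r n]%classic) (gaussk (a * (t - s)) z)%:E)%E.
  apply: ge0_nondecreasing_set_cvg_integral => //.
  - move=> m n mn; apply/subsetPset => s /=; rewrite !in_itv/=.
    move=> /andP[-> /le_trans]; apply.
    by rewrite lerD2l lerN2 ler_pM2l// lef_pV2 ?posrE// ler_nat.
  - by move=> n; exact: mg.
  - by move=> n s _; rewrite lee_fin gaussk_ge0.
rewrite -integral_itv_bndo_bndc// -bigU.
have cvg2 : (((excess (a * t) z - excess (a * (t - r n)) z) / a)%:E) @[n --> \oo] -->
    (((excess (a * t) z - Num.max z 0) / a)%:E).
  apply: cvg_EFin; first exact: nearW.
  apply: cvgM; last exact: cvg_cst.
  apply: cvgB; first exact: cvg_cst.
  apply: cvg_excess0 => [n|]; first by rewrite mulr_gt0// subr_gt0.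
  rewrite -(mulr0 a); apply: cvgM; first exact: cvg_cst.
  by under eq_fun do rewrite /r opprB addrCA subrr addr0.
move: cvg1; under eq_fun do rewrite rint.
by move=> /(cvg_unique _) /(_ cvg2) ->.
Qed.

(** * Moments of the normal law *)

Section even_integral.
Variables (f F : R -> R) (l : R).
Hypotheses (f0 : forall x, 0 <= f x) (cf : continuous f)
  (fe : forall x, f (- x) = f x) (dF : forall x, is_derive x 1 F (f x))
  (Fl : F x @[x --> +oo%R] --> l).

(** Evenness reduces the integral to the half-line, where it is computed by a
    primitive with a limit at infinity. *)
Lemma integral_even_FTC : (\int[mu]_x (f x)%:E = (2 * (l - F 0))%:E)%E.
Proof.
have fe' : f =1 f \o -%R by move=> x; rewrite /= fe.
rewrite (ge0_symfun_integralT f0 cf fe').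
rewrite (_ : [set y : R | 0 <= y] = `[0%R, +oo[%classic); last first.
  by apply/seteqP; split => y /=; rewrite in_itv/= andbT.
rewrite (@ge0_continuous_FTC2y R f F 0 l)//.
- exact: continuous_subspaceT.
- apply: cvg_at_right_filter.
  by apply/differentiable_continuous/derivable1_diffP; case: (dF 0).
- by move=> x _; rewrite derive1E; have [_ ->] := dF x.
Qed.

End even_integral.

Lemma ncdf0 s : s != 0 -> ncdf s 0 = 2^-1.
Proof.
move=> s0; have := integral_normal_pdf 0 s.
have pe x : normal_pdf 0 s (- x) = normal_pdf 0 s x by rewrite normal_pdf0E// sqrrN.
rewrite (integral_even_FTC (normal_pdf_ge0 0 s) (continuous_normal_pdf s0) pe
  (fun x => is_derive_ncdf x s0) (@ncdf_y R s)).
by case; lra.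
Qed.

Lemma cvg_mul_normal_pdf s k : s != 0 -> (k < 4)%N ->
  x ^+ k * normal_pdf 0 s x @[x --> +oo%R] --> (0 : R).
Proof.
move=> s0 k4.
have s20 : 0 < s ^+ 2 by rewrite exprn_even_gt0.
(* With v = x^2 / (2 s^2), the bound exp v >= v^2 / 2 gives
   x^3 exp (- v) <= 8 s^4 / x. *)
pose C := normal_peak s * (8 * (s ^+ 2) ^+ 2).
have C0 : 0 < C.
  by apply: mulr_gt0; [exact: normal_peak_gt0|apply: mulr_gt0 => //; exact: exprn_gt0].
apply: (@squeeze_cvgr _ _ _ _ (cst 0) (fun x => C * x^-1)).
- near=> x.
  have x1 : 1 <= x by near: x; exact: nbhs_pinfty_ge.
  have x0 : 0 < x by exact: lt_le_trans x1.
  rewrite mulr_ge0 ?normal_pdf_ge0 ?exprn_ge0 ?(ltW x0)//=.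
  rewrite normal_pdf0E// expRN mulrCA /C -mulrA ler_pM2l ?normal_peak_gt0//.
  have u0 : 0 <= x ^+ 2 / (s ^+ 2 *+ 2).
    by rewrite divr_ge0 ?sqr_ge0// mulrn_wge0// ltW.
  rewrite ler_pdivrMr ?expR_gt0//.
  have kx : x ^+ k <= x ^+ 3 by rewrite ler_eXn2l.
  apply: (le_trans kx).
  have e2 := expR_ge1Dxn 1 u0.
  have e3 : x ^+ 4 / (8 * (s ^+ 2) ^+ 2) <= expR (x ^+ 2 / (s ^+ 2 *+ 2)).
    apply: le_trans e2; rewrite ler_wpDl//.
    rewrite le_eqVlt; apply/orP; left; apply/eqP.
    rewrite -[(s ^+ 2 *+ 2)]mulr_natr -[2`!]/2%N (exprM x 2 2).
    by move: (s ^+ 2) s20 => v v0; field; exact: lt0r_neq0.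
  have w0 : 0 < 8 * (s ^+ 2) ^+ 2 / x.
    by apply: divr_gt0 => //; apply: mulr_gt0 => //; exact: exprn_gt0.
  rewrite -ler_pdivrMl//; apply: le_trans e3.
  rewrite le_eqVlt; apply/orP; left; apply/eqP.
  by move: (s ^+ 2) s20 => v v0; field; rewrite !lt0r_neq0.
- exact: cvg_cst.
- rewrite -(mulr0 C); apply: cvgM; first exact: cvg_cst.
  have pos : \forall x \near +oo%R, 0 < (id x : R) by exact: nbhs_pinfty_gt.
  exact: (gtr0_cvgV0 pos).2 cvg_id.
Unshelve. all: by end_near. Qed.

(** Integration by parts gives an explicit primitive in terms of [ncdf]. *)
Lemma normal_moment2 s : s != 0 ->
  (\int[mu]_x (x ^+ 2 * normal_pdf 0 s x)%:E = (s ^+ 2)%:E)%E.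
Proof.
move=> s0.
have s20 : s ^+ 2 != 0 by rewrite expf_neq0.
have dp x := @is_derive_normal_pdf _ s x s0.
have dn x := @is_derive_ncdf _ s x s0.
pose F x := s ^+ 2 * (ncdf s x - x * normal_pdf 0 s x).
have dF x : is_derive x 1 F (x ^+ 2 * normal_pdf 0 s x).
  have := dp x; have := dn x => ? ?.
  by apply: is_derive_eq; rewrite /GRing.scale/=; field.
have Fl : F x @[x --> +oo%R] --> s ^+ 2.
  rewrite -[X in _ --> X]mulr1; apply: cvgM; first exact: cvg_cst.
  rewrite -[X in _ --> X]subr0; apply: cvgB; first exact: ncdf_y.
  exact: (@cvg_mul_normal_pdf s 1 s0).
rewrite (integral_even_FTC _ _ _ dF Fl).
- by rewrite /F ncdf0// mul0r subr0; congr (_%:E); field.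
- by move=> x; rewrite mulr_ge0 ?sqr_ge0 ?normal_pdf_ge0.
- move=> x; apply: cvgM; first exact: exprn_continuous.
  exact: continuous_normal_pdf.
- by move=> x; rewrite sqrrN normal_pdf0E// sqrrN.
Qed.

Lemma normal_moment4 s : s != 0 ->
  (\int[mu]_x (x ^+ 4 * normal_pdf 0 s x)%:E = (3 * s ^+ 4)%:E)%E.
Proof.
move=> s0.
have s20 : s ^+ 2 != 0 by rewrite expf_neq0.
have dp x := @is_derive_normal_pdf _ s x s0.
have dn x := @is_derive_ncdf _ s x s0.
(* Two integrations by parts. *)
pose F x := 3 * s ^+ 4 * (ncdf s x - x * normal_pdf 0 s x)
            - s ^+ 2 * (x ^+ 3 * normal_pdf 0 s x).
have dF x : is_derive x 1 F (x ^+ 4 * normal_pdf 0 s x).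
  have := dp x; have := dn x => ? ?.
  by apply: is_derive_eq; rewrite /GRing.scale/=; field.
have Fl : F x @[x --> +oo%R] --> 3 * s ^+ 4.
  rewrite -[X in _ --> X]subr0; apply: cvgB.
    rewrite -[X in _ --> X]mulr1; apply: cvgM; first exact: cvg_cst.
    rewrite -[X in _ --> X]subr0; apply: cvgB; first exact: ncdf_y.
    exact: (@cvg_mul_normal_pdf s 1 s0).
  rewrite -[X in _ --> X](mulr0 (s ^+ 2)); apply: cvgM; first exact: cvg_cst.
  exact: (@cvg_mul_normal_pdf s 3 s0).
rewrite (integral_even_FTC _ _ _ dF Fl).
- by rewrite /F ncdf0// !mul0r !expr0n/= !mul0r mulr0 !subr0; congr (_%:E); field.
- by move=> x; rewrite mulr_ge0 ?normal_pdf_ge0// (exprM x 2 2) sqr_ge0.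
- move=> x; apply: cvgM; first exact: exprn_continuous.
  exact: continuous_normal_pdf.
- by move=> x; rewrite (exprM (- x) 2 2) sqrrN -exprM normal_pdf0E// sqrrN.
Qed.

End gaussian_integrals.

(** * Sums over the integers and periodization *)

Section integer_sums.
Context {R : realType}.
Notation mu := (@lebesgue_measure R).

(** Even numbers enumerate the nonnegative integers, odd numbers the negative ones.
    It turns a sum over the integers into a series, for which integrals and sums
    can be exchanged. *)
Definition int_of_nat (n : nat) : int := if odd n then Negz n./2 else Posz n./2.

Lemma int_of_nat_bij : set_bij [set: nat] [set: int] int_of_nat.
Proof.
split => [//|m n _ _|[n|n] _] /=.
- rewrite /int_of_nat; have := odd_double_half m; have := odd_double_half n.
  by case: (odd m); case: (odd n) => //= hn hm [e]; rewrite -hm -hn e.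
- by exists n.*2 => //; rewrite /int_of_nat odd_double doubleK.
- by exists n.*2.+1 => //; rewrite /int_of_nat /= odd_double /= uphalf_double.
Qed.

Lemma esum_int (a : int -> \bar R) : (forall k, 0 <= a k)%E ->
  (\esum_(k in [set: int]) a k = \sum_(n <oo) a (int_of_nat n))%E.
Proof.
by move=> a0; rewrite (reindex_esum _ _ _ _ int_of_nat_bij) nneseries_esumT.
Qed.

Lemma esum_int_shift (a : int -> \bar R) (j : int) :
  (\esum_(k in [set: int]) a (k + j)%R = \esum_(k in [set: int]) a k)%E.
Proof.
apply/esym/reindex_esum; split => [//|k k' _ _ /addIr //|k _].
by exists (k - j)%R => //; rewrite subrK.
Qed.

Section swap.
Context d (T : measurableType d).
Variables (m : {measure set T -> \bar R}) (D : set T) (mD : measurable D).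
Variable f : int -> T -> \bar R.
Hypotheses (f0 : forall k x, (0 <= f k x)%E) (mf : forall k, measurable_fun D (f k)).

Lemma measurable_esum_int :
  measurable_fun D (fun x => \esum_(k in [set: int]) f k x)%E.
Proof.
under eq_fun do rewrite esum_int//.
exact: (@ge0_emeasurable_sum _ _ _ D (fun n => f (int_of_nat n)) xpredT).
Qed.

Lemma integral_esum_int :
  (\int[m]_(x in D) (\esum_(k in [set: int]) f k x) =
   \esum_(k in [set: int]) \int[m]_(x in D) f k x)%E.
Proof.
under eq_integral do rewrite esum_int//.
rewrite integral_nneseries// esum_int// => k.
exact: integral_ge0.
Qed.

End swap.

Lemma esum_intZl (c : R) (a : int -> \bar R) : 0 <= c -> (forall k, 0 <= a k)%E ->
  (\esum_(k in [set: int]) (c%:E * a k) = c%:E * \esum_(k in [set: int]) a k)%E.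
Proof.
move=> c0 a0; rewrite !esum_int// => [|k]; last by rewrite mule_ge0// lee_fin.
by rewrite nneseriesZl.
Qed.

(** The image of Lebesgue measure under a translation gives each interval its
    length, hence is Lebesgue measure. *)
Lemma integral_shift (f : R -> \bar R) (c : R) :
  measurable_fun setT f -> (forall x, 0 <= f x)%E ->
  (\int[mu]_x f (x + c)%R = \int[mu]_x f x)%E.
Proof.
move=> mf f0.
have mS : measurable_fun [set: measurableTypeR R] (fun x : R => x + c : measurableTypeR R).
  exact: measurable_funD.
pose nu := pushforward mu (fun x : R => x + c : measurableTypeR R).
have muE A : measurable A -> mu A = nu A.
  apply: lebesgue_measure_unique => X [[a b] _ <-].
  have nuE : nu `]a, b]%classic = mu `]a - c, b - c]%classic.
    rewrite /nu /pushforward; congr (lebesgue_measure _).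
    by apply/seteqP; split => x /=; rewrite !in_itv/= ltrBlDr lerBrDr.
  apply: (eq_trans _ (esym nuE)).
  rewrite !lebesgue_measure_itv /= !lte_fin ltrD2r; case: ifP => // _.
  by rewrite -!EFinB; congr (_%:E); ring.
rewrite [RHS](@eq_measure_integral _ _ _ _ nu)//; last by move=> A mA _; exact: muE.
by rewrite ge0_integral_pushforward.
Qed.

(** The translates of [0, 1[ by the integers tile the line, so that integrating a
    periodization over one period amounts to integrating over the line. *)
Lemma integral_unfold (q : R -> R) (phi : R -> \bar R) :
  measurable_fun setT q -> measurable_fun setT phi ->
  (forall x, 0 <= q x) -> (forall x, 0 <= phi x)%E ->
  (forall x (k : int), q (x + k%:~R) = q x) ->
  (\int[mu]_(y in `[0%R, 1%R[) ((q y)%:E * \esum_(k in [set: int]) phi (y + k%:~R)%R) =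
   \int[mu]_y ((q y)%:E * phi y))%E.
Proof.
move=> mq mphi q0 phi0 qper.
have mq' : measurable_fun setT (fun y : R => (q y)%:E) by exact/measurable_EFinP.
have q0' y : (0 <= (q y)%:E)%E by rewrite lee_fin.
have mphik (k : int) : measurable_fun setT (fun y : R => phi (y + k%:~R)).
  by apply: measurableT_comp => //; exact: measurable_funD.
have g0 y : (0 <= (q y)%:E * phi y)%E by exact: mule_ge0.
transitivity (\esum_(k in [set: int])
    \int[mu]_(y in `[0%R, 1%R[) ((q y)%:E * phi (y + k%:~R)%R))%E.
  under eq_integral do rewrite -esum_intZl//.
  apply: integral_esum_int => //; first by move=> k y; exact: mule_ge0.
  by move=> k; apply: measurable_funTS; apply: emeasurable_funM; [exact: mq'|exact: mphik].
pose J (k : int) := `[k%:~R, k%:~R + 1[%classic : set R.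
transitivity (\esum_(k in [set: int]) \int[mu]_(y in J k) ((q y)%:E * phi y))%E.
  apply: eq_esum => k _.
  rewrite integral_mkcond [RHS]integral_mkcond.
  rewrite -[RHS](@integral_shift _ k%:~R).
  - apply: eq_integral => y _; rewrite !patchE.
    have -> : (y + k%:~R \in J k) = (y \in (`[0%R, 1%R[%classic : set R)).
      apply/idP/idP; rewrite !inE /J /= !in_itv /= => /andP[? ?]; apply/andP; split; lra.
    by rewrite qper.
  - apply/(measurable_restrictT _ _).1 => //; first exact: measurable_itv.
    exact/measurable_funTS/emeasurable_funM.
  - by move=> y; rewrite patchE; case: ifP.
rewrite esum_int; last by move=> k; exact: integral_ge0.
rewrite -(@ge0_integral_bigcup _ _ _ mu (fun n => J (int_of_nat n))).
- congr (integral _ _ _); apply/seteqP; split => // y _.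
  have [n _ nE] : exists2 n, [set: nat] n & int_of_nat n = Num.floor y.
    by have [_ _ /(_ (Num.floor y) I)] := int_of_nat_bij.
  exists n => //; rewrite /J nE /= in_itv/= floor_le/=.
  by rewrite -[1]/(1%:~R) -intrD floorD1_gt.
- by move=> n; exact: measurable_itv.
- exact/measurable_funTS/emeasurable_funM.
- by [].
- apply/trivIsetP => m n _ _ mn; apply/seteqP; split => // y [].
  rewrite /J /= !in_itv/= => /andP[a1 a2] /andP[b1 b2].
  have inj : int_of_nat m = int_of_nat n -> m = n.
    by have [_ + _] := int_of_nat_bij; apply; rewrite inE.
  case/eqP: mn; apply: inj; apply/eqP; rewrite eq_le.
  have := le_lt_trans a1 b2; have := le_lt_trans b1 a2.
  rewrite -[1]/(1%:~R) -!intrD !ltr_int !ltzD1 => -> ->//.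
Qed.

End integer_sums.

(** * The heat kernel on the torus *)

Section torus_heat_kernel.
Context {R : realType}.
Notation mu := (@lebesgue_measure R).
Implicit Types (s r x z h : R).

(** The heat kernel with values in the extended reals: sums and integrals of
    nonnegative terms can then be exchanged without proving finiteness, which
    [eheat_le] supplies. *)
Definition eheat s x : \bar R := \esum_(k in [set: int]) (gaussk s (x - k%:~R))%:E.

Lemma eheat_ge0 s x : (0 <= eheat s x)%E.
Proof. by apply: esum_ge0 => k _; rewrite lee_fin gaussk_ge0. Qed.

Lemma eheat_shift s x (k : int) : eheat s (x + k%:~R) = eheat s x.
Proof.
rewrite /eheat -(esum_int_shift _ k); apply: eq_esum => j _.
by congr ((gaussk _ _)%:E); rewrite intrD; ring.
Qed.

Lemma eheat_unfold s x y :
  eheat s (x - y) = \esum_(k in [set: int]) (gaussk s (y + k%:~R - x))%:E.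
Proof.
by apply: eq_esum => k _; rewrite -gausskN; congr ((gaussk _ _)%:E); ring.
Qed.

Lemma measurable_eheat d (T : measurableType d) (f g : T -> R) :
  measurable_fun setT f -> measurable_fun setT g ->
  measurable_fun setT (fun w => eheat (f w) (g w)).
Proof.
move=> mf mg; apply: measurable_esum_int => [k w|k]; first by rewrite lee_fin gaussk_ge0.
by apply/measurable_EFinP/measurable_gaussk => //; exact: measurable_funB.
Qed.

Lemma measurable_gausskB s x : measurable_fun setT (fun y : R => gaussk s (y - x)).
Proof. by apply: measurable_gaussk => //; exact: measurable_funB. Qed.

Lemma integral_gaussk_shift s x : 0 < s -> (\int[mu]_y (gaussk s (y - x)%R)%:E = 1)%E.
Proof.
move=> s0; rewrite -(integral_gaussk s0).
rewrite -(@integral_shift _ (fun y => (gaussk s y)%:E) (- x))//.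
  by apply/measurable_EFinP; exact: measurable_gaussk.
by move=> y; rewrite lee_fin gaussk_ge0.
Qed.

Lemma integral_eheat s x : 0 < s -> (\int[mu]_(y in `[0%R, 1%R[) eheat s (x - y) = 1)%E.
Proof.
move=> s0; rewrite -(integral_gaussk_shift x s0).
under eq_integral do rewrite eheat_unfold.
under [RHS]eq_integral do rewrite -[X in X%:E]mul1r EFinM.
rewrite -(@integral_unfold _ (cst 1) (fun y => (gaussk s (y - x))%:E))//.
- by apply: eq_integral => y _; rewrite mul1e.
- by apply/measurable_EFinP; exact: measurable_gausskB.
- by move=> y; rewrite lee_fin gaussk_ge0.
Qed.

Lemma lebesgue_measure01 : mu `[0%R, 1%R[%classic = 1%E.
Proof. by rewrite lebesgue_measure_itv/= lte_fin ltr01 oppr0 adde0. Qed.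

Definition gaussk_cst s : R := Num.sqrt 2 * expR s^-1.

Lemma gaussk_cst_ge0 s : 0 <= gaussk_cst s.
Proof. by rewrite mulr_ge0 ?expR_ge0. Qed.

(** Harnack-type comparison of the kernel at two points at distance at most 2. It
    follows from b^2 <= 2 a^2 + 2 (a - b)^2 <= 2 a^2 + 8. *)
Lemma gaussk_le s (a b : R) : 0 < s -> `|a - b| <= 2 ->
  gaussk s a <= gaussk_cst s * gaussk (2 * s) b.
Proof.
move=> s0 ab; rewrite /gaussk /gaussk_cst.
have c0 : 0 <= 4 * pi * s by rewrite !mulr_ge0 ?pi_ge0 ?ltW.
rewrite (_ : 4 * pi * (2 * s) = 2 * (4 * pi * s)); last by ring.
rewrite (sqrtrM (4 * pi * s)) ?ler0n//.
have -> (q A B : R) : Num.sqrt 2 * A * ((Num.sqrt 2 * q)^-1 * B) = q^-1 * (A * B).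
  rewrite invfM; have : Num.sqrt 2 != 0 :> R by rewrite gt_eqF ?sqrtr_gt0.
  by move: (Num.sqrt 2) (q^-1) => w q' w0; field.
rewrite ler_wpM2l ?invr_ge0// -expRD ler_expR.
have : (a - b) ^+ 2 <= 4.
  rewrite -(real_normK (num_real _)) (_ : 4 = 2 ^+ 2); last by ring.
  by rewrite lerXn2r ?nnegrE.
move=> ab2; rewrite -subr_ge0.
have -> : s^-1 + - b ^+ 2 / (4 * (2 * s)) - - a ^+ 2 / (4 * s) =
   (8 * s)^-1 * ((2 * a - b) ^+ 2 + 2 * (4 - (a - b) ^+ 2)).
  by field; exact: lt0r_neq0.
apply: mulr_ge0; first by rewrite invr_ge0 mulr_ge0// ltW.
by apply: addr_ge0; [exact: sqr_ge0|rewrite mulr_ge0// subr_ge0].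
Qed.

(** The bound is averaged over v in [0, 1[: the periodized kernel has total mass 1
    on a period, so that its values need not be estimated. *)
Lemma esum_gaussk_bound s (a : int -> R) (C z : R) : 0 < s -> 0 <= C ->
  (forall k, 0 <= a k) ->
  (forall k v, 0 <= v -> v < 1 -> a k <= C * gaussk s (z - v - k%:~R)) ->
  (\esum_(k in [set: int]) (a k)%:E <= C%:E)%E.
Proof.
move=> s0 C0 a0 aC.
have h v : 0 <= v -> v < 1 ->
    (\esum_(k in [set: int]) (a k)%:E <= C%:E * eheat s (z - v))%E.
  move=> v0 v1; rewrite -esum_intZl//; last by move=> k; rewrite lee_fin gaussk_ge0.
  by apply: le_esum => k _; rewrite -EFinM lee_fin; exact: aC.
have e0 : (0 <= \esum_(k in [set: int]) (a k)%:E)%E.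
  by apply: esum_ge0 => k _; rewrite lee_fin.
have : (\int[mu]_(v in `[0%R, 1%R[) (\esum_(k in [set: int]) (a k)%:E) <=
   \int[mu]_(v in `[0%R, 1%R[) (C%:E * eheat s (z - v)))%E.
  have me : measurable_fun setT (fun v : R => eheat s (z - v)).
    by apply: measurable_eheat => //; exact: measurable_funB.
  apply: ge0_le_integral => //.
  - by apply: measurable_funTS; exact: measurable_funeM.
  - by move=> v; rewrite /= in_itv/= => /andP[v0 v1]; exact: h.
rewrite ge0_integralZl//.
  rewrite integral_eheat// mule1 integral_cst//; apply: le_trans.
  rewrite -[leLHS]mule1 le_eqVlt; apply/orP; left; apply/eqP; congr (_ * _)%E.
  exact/esym/lebesgue_measure01.
- apply: measurable_funTS.
  by apply: measurable_eheat => //; exact: measurable_funB.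
- by move=> v _; exact: eheat_ge0.
Qed.

Lemma eheat_le s z : 0 < s -> (eheat s z <= (gaussk_cst s)%:E)%E.
Proof.
move=> s0; apply: (@esum_gaussk_bound (2 * s) _ _ z).
- exact: mulr_gt0.
- exact: gaussk_cst_ge0.
- by move=> k; exact: gaussk_ge0.
- move=> k v v0 v1; apply: gaussk_le => //.
  rewrite (_ : z - k%:~R - (z - v - k%:~R) = v); last by ring.
  by rewrite ger0_norm//; lra.
Qed.

Lemma eheat0 s z : s <= 0 -> eheat s z = 0.
Proof.
move=> s0; apply: esum1 => k _; rewrite /gaussk ler0_sqrtr ?invr0 ?mul0r//.
by rewrite mulr_ge0_le0// mulr_ge0// pi_ge0.
Qed.

(** For s > 0 the sum is finite; for s <= 0 all terms vanish. *)
Lemma heat_kernelE s z : (heat_kernel s z)%:E = eheat s z.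
Proof.
rewrite /heat_kernel -/(eheat s z) fineK//.
have [s0|s0] := leP s 0; first by rewrite eheat0.
by rewrite ge0_fin_numE ?eheat_ge0// (le_lt_trans (eheat_le _ s0)) ?ltry.
Qed.

Lemma heat_kernel_ge0 s z : 0 <= heat_kernel s z.
Proof. by rewrite -lee_fin heat_kernelE eheat_ge0. Qed.

Lemma measurable_heat_kernel d (T : measurableType d) (f g : T -> R) :
  measurable_fun setT f -> measurable_fun setT g ->
  measurable_fun setT (fun w => heat_kernel (f w) (g w)).
Proof.
move=> mf mg; apply/measurable_EFinP.
rewrite (_ : EFin \o _ = fun w => eheat (f w) (g w)); first exact: measurable_eheat.
by apply/funext => w; exact: heat_kernelE.
Qed.

Lemma heat_kernel_shift s x (k : int) : heat_kernel s (x + k%:~R) = heat_kernel s x.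
Proof. by apply/EFin_inj; rewrite !heat_kernelE eheat_shift. Qed.

(** Completing the square, in the variables a - b and (a + b) / 2. *)
Lemma gausskM s (a b : R) : 0 < s ->
  gaussk s a * gaussk s b = gaussk (2 * s) (a - b) * gaussk (2^-1 * s) ((a + b) / 2).
Proof.
move=> s0; have ? := @pi_gt0 R; rewrite /gaussk mulrACA [RHS]mulrACA -!invfM -!expRD.
rewrite -!sqrtrM ?mulr_ge0 ?(ltW s0) ?pi_ge0//.
congr ((Num.sqrt _)^-1 * expR _); first by field.
by field; exact: lt0r_neq0.
Qed.

(** The semigroup property: one factor is unfolded, so that the integral runs over
    the line, and [gausskM] is applied to each term of the other one. *)
Lemma heat_kernel_conv s x x' : 0 < s ->
  (\int[mu]_(y in `[0%R, 1%R[) (heat_kernel s (x - y) * heat_kernel s (x' - y))%:E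
   = eheat (2 * s) (x - x'))%E.
Proof.
move=> s0.
transitivity (\int[mu]_y ((heat_kernel s (x - y))%:E * (gaussk s (y - x'))%:E))%E.
  rewrite -integral_unfold.
  - by apply: eq_integral => y _; rewrite EFinM [X in (_ * X)%E]heat_kernelE eheat_unfold.
  - by apply: measurable_heat_kernel => //; exact: measurable_funB.
  - by apply/measurable_EFinP; exact: measurable_gausskB.
  - by move=> y; exact: heat_kernel_ge0.
  - by move=> y; rewrite lee_fin gaussk_ge0.
  - move=> y k; rewrite opprD addrA (_ : - k%:~R = (- k)%:~R) ?heat_kernel_shift//.
    by rewrite intrN.
transitivity (\int[mu]_y \esum_(k in [set: int])
    ((gaussk s (y + k%:~R - x)%R)%:E * (gaussk s (y - x')%R)%:E))%E.
  apply: eq_integral => y _; rewrite heat_kernelE eheat_unfold muleC -esum_intZl ?gaussk_ge0//.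
    by apply: eq_esum => k _; rewrite muleC.
  by move=> k; rewrite lee_fin gaussk_ge0.
rewrite integral_esum_int//.
- apply: eq_esum => k _.
  pose c : R := (x + x' - k%:~R) / 2.
  transitivity (\int[mu]_y ((gaussk (2 * s) (x - x' - k%:~R))%:E *
      (gaussk (2^-1 * s) (y - c)%R)%:E))%E.
    apply: eq_integral => y _; rewrite -!EFinM gausskM// -gausskN /c.
    congr ((gaussk _ _ * gaussk _ _)%:E); by field.
  rewrite ge0_integralZl//.
  - by rewrite integral_gaussk_shift ?mule1// mulr_gt0// invr_gt0.
  - by apply/measurable_EFinP; exact: measurable_gausskB.
  - by move=> y _; rewrite lee_fin gaussk_ge0.
  - by rewrite lee_fin gaussk_ge0.
- by move=> k y; rewrite -EFinM lee_fin mulr_ge0 ?gaussk_ge0.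
- move=> k; apply: emeasurable_funM; apply/measurable_EFinP.
    apply: measurable_gaussk => //; apply: measurable_funB => //; exact: measurable_funD.
  exact: measurable_gausskB.
Qed.

End torus_heat_kernel.

(** * Covariance of the stochastic convolution *)

Section heat_covariance.
Context {R : realType}.
Notation mu := (@lebesgue_measure R).
Implicit Types (a s r t x z h : R).

(** With a = 2 eps and z = x - x', the covariance of the stochastic convolution at
    time t. *)
Definition heat_cov a t z : \bar R :=
  (\int[mu]_(s in `[0%R, t]) eheat (a * (t - s))%R z)%E.

(** The product of a and of the analogue of [heat_cov a t z] on the line, see
    [integral_gaussk_time]. *)
Definition line_cov a t z : R := excess (a * t) z - Num.max z 0.

Lemma line_cov_ge0 a t z : 0 < a -> 0 < t -> 0 <= line_cov a t z.
Proof.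
move=> a0 t0; have := integral_gaussk_time z a0 t0; rewrite -/(line_cov a t z) => E.
have : (0 <= (line_cov a t z / a)%:E)%E.
  by rewrite -E; apply: integral_ge0 => s _; rewrite lee_fin gaussk_ge0.
by rewrite lee_fin pmulr_lge0// invr_gt0.
Qed.

Lemma heat_cov_esum a t z : 0 < a -> 0 < t ->
  (a%:E * heat_cov a t z = \esum_(k in [set: int]) (line_cov a t (z - k%:~R)%R)%:E)%E.
Proof.
move=> a0 t0; rewrite /heat_cov /eheat integral_esum_int//.
- rewrite -esum_intZl ?(ltW a0)//; last first.
    by move=> k; apply: integral_ge0 => s _; rewrite lee_fin gaussk_ge0.
  apply: eq_esum => k _; rewrite integral_gaussk_time// -EFinM /line_cov.
  by congr (_%:E); field; exact: lt0r_neq0.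
- by move=> k s; rewrite lee_fin gaussk_ge0.
- move=> k; apply/measurable_funTS/measurable_EFinP/measurable_gaussk => //.
  by apply: measurable_funM => //; exact: measurable_funB.
Qed.

(** The positive part is affine on each side of its kink. *)
Lemma hat_diff2 (v h : R) : 0 <= h -> h <= `|v| ->
  Num.max (v + h) 0 + Num.max (v - h) 0 - 2 * Num.max v 0 = 0.
Proof.
move=> h0; have [v0|v0] := ger0P v => hv.
  rewrite !max_l//; lra.
by rewrite !max_r ?addr0 ?mulr0 ?subr0//; lra.
Qed.

(** An extended-real identity without subtraction, solved in the reals. *)
Lemma fine_linear_eq a (T : R) (c1 c2 c3 D : \bar R) : 0 < a ->
  c1 \is a fin_num -> c2 \is a fin_num -> c3 \is a fin_num -> D \is a fin_num ->
  (2%:E * (a%:E * c1) + D = a%:E * c2 + a%:E * c3 + T%:E)%E ->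
  2 * fine c1 - fine c2 - fine c3 = (T - fine D) / a.
Proof.
move=> a0; case: c1 c2 c3 D => [c1||] [c2||] [c3||] [D||] //= _ _ _ _ [e].
apply: (mulIf (lt0r_neq0 a0)); rewrite divfK ?lt0r_neq0//; lra.
Qed.

(** In the sum over the integers, the positive part contributes only through its
    kink, hence only for z = 0: otherwise h <= |z| <= 1 - h keeps all the points
    z - k at distance at least h from 0. The function [excess] contributes the
    error D. *)
Lemma heat_cov_diff2 a t z h : 0 < a -> 0 < t -> 0 <= h <= 1 ->
  z = 0 \/ h <= `|z| <= 1 - h ->
  heat_cov a t z \is a fin_num -> heat_cov a t (z + h) \is a fin_num ->
  heat_cov a t (z - h) \is a fin_num ->
  exists2 D : R, 0 <= D <= 2 * gaussk_cst (a * t) * h ^+ 2 &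
    2 * fine (heat_cov a t z) - fine (heat_cov a t (z + h)) - fine (heat_cov a t (z - h)) =
    ((if z == 0 then h else 0) - D) / a.
Proof.
move=> a0 t0 /andP[h0 h1] hz f1 f2 f3.
have at0 : 0 < a * t by exact: mulr_gt0.
(* Up to the factor a, the k-th term of the covariance is [excess] minus the
   positive part at z - k; Dk and Tk are their second differences. *)
pose Dk (k : int) := excess (a * t) (z - k%:~R + h) + excess (a * t) (z - k%:~R - h)
  - 2 * excess (a * t) (z - k%:~R).
have Dkb k v : 0 <= v -> v < 1 ->
    0 <= Dk k <= 2 * gaussk_cst (a * t) * h ^+ 2 * gaussk (2 * (a * t)) (z - v - k%:~R).
  move=> v0 v1; rewrite [X in _ <= _ <= X](_ : _ =
    2 * (gaussk_cst (a * t) * gaussk (2 * (a * t)) (z - v - k%:~R)) * h ^+ 2); last by ring.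
  apply: excess_diff2 => // y /andP[y1 y2]; apply: gaussk_le => //.
  rewrite ler_norml; apply/andP; split; lra.
have Dk0 k : 0 <= Dk k by have /andP[] := Dkb k 0 (lexx _) ltr01.
have DE : (\esum_(k in [set: int]) (Dk k)%:E <= (2 * gaussk_cst (a * t) * h ^+ 2)%:E)%E.
  apply: (@esum_gaussk_bound _ (2 * (a * t)) _ _ z) => //.
  - exact: mulr_gt0.
  - by rewrite mulr_ge0 ?sqr_ge0// mulr_ge0// gaussk_cst_ge0.
  - by move=> k v v0 v1; have /andP[] := Dkb k v v0 v1.
have De0 : (0 <= \esum_(k in [set: int]) (Dk k)%:E)%E.
  by apply: esum_ge0 => k _; rewrite lee_fin.
have Dfin : \esum_(k in [set: int]) (Dk k)%:E \is a fin_num.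
  by rewrite ge0_fin_numE// (le_lt_trans DE) ?ltry.
exists (fine (\esum_(k in [set: int]) (Dk k)%:E)).
  rewrite -!lee_fin fineK//; apply/andP; split => //.
pose Tk (k : int) : R := Num.max (z - k%:~R + h) 0 + Num.max (z - k%:~R - h) 0
  - 2 * Num.max (z - k%:~R) 0.
have TkE k : Tk k = if k == 0 then (if z == 0 then h else 0) else 0.
  rewrite /Tk; case: ifPn => [/eqP ->|k0].
    rewrite subr0; case: ifPn => [/eqP ->|z0].
      by rewrite add0r sub0r maxxx mulr0 subr0 max_l// max_r ?oppr_le0// addr0.
    apply: hat_diff2 => //; case: hz => [zE|/andP[]//].
    by rewrite zE eqxx in z0.
  apply: hat_diff2 => //.
  have k1 : 1 <= `|k%:~R : R| by rewrite -intr_norm ler1z -gtz0_ge1 normr_gt0.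
  have : `|z| <= 1 - h by case: hz => [->|/andP[//]]; rewrite normr0; lra.
  move=> zh; have := lerB_normD (k%:~R) (- z); rewrite normrN distrC.
  have := ler_normD (k%:~R - z) z; rewrite subrK => n1 n2; lra.
have TE : (\esum_(k in [set: int]) (Tk k)%:E = (if z == 0 then h else 0)%:E)%E.
  rewrite (_ : (fun k => (Tk k)%:E) = fun k => if k \in [set (0:int)] then
     (if z == 0 then h else 0)%:E else 0%E).
    by rewrite -esum_mkcond esum_set1// lee_fin; case: ifP.
  apply/funext => k; rewrite TkE; case: (eqVneq k 0) => [->|k0].
    by rewrite mem_set.
  by rewrite memNset//= => /eqP; exact/negP.
have key : (2%:E * (a%:E * heat_cov a t z) + \esum_(k in [set: int]) (Dk k)%:E =
   a%:E * heat_cov a t (z + h)%R + a%:E * heat_cov a t (z - h)%R +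
   (if z == 0 then h else 0)%:E)%E.
  have Tk0 k : 0 <= Tk k by rewrite TkE; case: ifP => //; case: ifP.
  have c0 x k : (0 <= (line_cov a t (x - k%:~R))%:E)%E by rewrite lee_fin line_cov_ge0.
  transitivity (\esum_(k in [set: int])
      (2%:E * (line_cov a t (z - k%:~R))%:E + (Dk k)%:E))%E.
    rewrite esumD; first (congr (_ + _)%E;
      rewrite esum_intZl//; congr (_ * _)%E; exact: heat_cov_esum).
    - by move=> k _; rewrite mule_ge0.
    - by move=> k _; rewrite lee_fin.
  transitivity (\esum_(k in [set: int]) ((line_cov a t (z + h - k%:~R))%:E +
      (line_cov a t (z - h - k%:~R))%:E + (Tk k)%:E))%E; last first.
    rewrite esumD; first (congr (_ + _)%E; last exact: TE).
      rewrite esumD; first (congr (_ + _)%E; exact/esym/heat_cov_esum).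
      by move=> k _; exact: c0.
      by move=> k _; exact: c0.
    - by move=> k _; rewrite adde_ge0.
    - by move=> k _; rewrite lee_fin.
  apply: eq_esum => k _; rewrite -EFinM -!EFinD; congr (_%:E).
  rewrite /line_cov /Dk /Tk (addrAC z h) (addrAC z (- h)).
  move: (excess _ _) (excess _ _) (excess _ _) (Num.max _ _) (Num.max _ _) (Num.max _ _).
  by move=> *; ring.
exact: fine_linear_eq key.
Qed.

End heat_covariance.

(** * Square-integrable functions *)

Section square_integrable.
Context d (T : measurableType d) {R : realType} (m : {measure set T -> \bar R}).
Implicit Types f g : T -> R.

Definition sqint f := measurable_fun setT f /\
  m.-integrable setT (fun x => (f x ^+ 2)%:E).

Definition ip f g : R := \int[m]_x (f x * g x).

Lemma integrable_dominated (f g : T -> R) : measurable_fun setT f ->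
  (forall x, `|f x| <= g x) -> m.-integrable setT (EFin \o g) ->
  m.-integrable setT (EFin \o f).
Proof.
move=> mf fg ig; apply: (le_integrable measurableT _ _ ig).
  exact/measurable_EFinP.
move=> x _ /=; rewrite lee_fin; apply: le_trans (fg x) _; exact: ler_norm.
Qed.

Lemma sqint_mul f g : sqint f -> sqint g ->
  m.-integrable setT (fun x => (f x * g x)%:E).
Proof.
move=> [mf if2] [mg ig2].
apply: (@integrable_dominated _ (fun x => f x ^+ 2 + g x ^+ 2)).
- exact: measurable_funM.
- move=> x; rewrite normrM -(real_normK (num_real (f x))) -(real_normK (num_real (g x))).
  move: (normr_ge0 (f x)) (normr_ge0 (g x)); move: (`|f x|) (`|g x|) => a b a0 b0; nra.
- exact: (integrableD measurableT if2 ig2).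
Qed.

Lemma sqint_lin f g (a b : R) : sqint f -> sqint g ->
  sqint (fun x => a * f x + b * g x).
Proof.
move=> sf sg; have [mf if2] := sf; have [mg ig2] := sg.
have mh : measurable_fun setT (fun x => a * f x + b * g x).
  by apply: measurable_funD; exact: measurable_funM.
split => //; apply: (@integrable_dominated _ (fun x => 2 * a ^+ 2 * f x ^+ 2 +
   2 * b ^+ 2 * g x ^+ 2)).
- exact: measurable_funX.
- move=> x; rewrite ger0_norm ?sqr_ge0//.
  have := sqr_ge0 (a * f x - b * g x); nra.
- exact: (integrableD measurableT (integrableZl measurableT _ if2)
    (integrableZl measurableT _ ig2)).
Qed.

Lemma sqint_ext f g : f =1 g -> sqint f -> sqint g.
Proof. by move=> /funext ->. Qed.

Lemma sqintD f g : sqint f -> sqint g -> sqint (fun x => f x + g x).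
Proof.
move=> sf sg; apply: sqint_ext (sqint_lin 1 1 sf sg) => x; by rewrite !mul1r.
Qed.

Lemma sqintB f g : sqint f -> sqint g -> sqint (fun x => f x - g x).
Proof.
move=> sf sg; apply: sqint_ext (sqint_lin 1 (-1) sf sg) => x.
by rewrite mul1r mulN1r.
Qed.

Lemma sqintZ f (a : R) : sqint f -> sqint (fun x => a * f x).
Proof.
move=> sf; apply: sqint_ext (sqint_lin a 0 sf sf) => x; by rewrite mul0r addr0.
Qed.

Lemma sqint0 : sqint (fun=> 0).
Proof. by split => //; under eq_fun do rewrite expr0n; exact: integrable0. Qed.

Lemma sqint_sum I (r : seq I) (F : I -> T -> R) : (forall i, sqint (F i)) ->
  sqint (fun x => \sum_(i <- r) F i x).
Proof.
move=> sF; elim: r => [|i r ih].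
  by apply: sqint_ext sqint0 => x; rewrite big_nil.
by apply: sqint_ext (sqintD (sF i) ih) => x; rewrite big_cons.
Qed.

Lemma sqint_norm f : sqint f -> sqint (fun x => `|f x|).
Proof.
move=> [mf if2]; split; first exact: measurableT_comp.
by under eq_fun do rewrite real_normK ?num_real//.
Qed.

Lemma ipC f g : ip f g = ip g f.
Proof. by apply: eq_Rintegral => x _; rewrite mulrC. Qed.

Lemma ip_linl f f' g (a b : R) : sqint f -> sqint f' -> sqint g ->
  ip (fun x => a * f x + b * f' x) g = a * ip f g + b * ip f' g.
Proof.
move=> sf sf' sg; rewrite /ip.
rewrite -RintegralZl ?sqint_mul// -RintegralZl ?sqint_mul//.
rewrite -RintegralD//; last 2 first.
- exact: (integrableZl measurableT a (sqint_mul sf sg)).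
- exact: (integrableZl measurableT b (sqint_mul sf' sg)).
by apply: eq_Rintegral => x _; ring.
Qed.

Lemma ipDl f f' g : sqint f -> sqint f' -> sqint g ->
  ip (fun x => f x + f' x) g = ip f g + ip f' g.
Proof.
move=> sf sf' sg; have := ip_linl 1 1 sf sf' sg; rewrite !mul1r => <-.
by apply: eq_Rintegral => x _; rewrite !mul1r.
Qed.

Lemma ipBl f f' g : sqint f -> sqint f' -> sqint g ->
  ip (fun x => f x - f' x) g = ip f g - ip f' g.
Proof.
move=> sf sf' sg; have := ip_linl 1 (-1) sf sf' sg; rewrite mul1r mulN1r => <-.
by apply: eq_Rintegral => x _; rewrite mul1r mulN1r.
Qed.

Lemma ipB f f' g g' : sqint f -> sqint f' -> sqint g -> sqint g' ->
  ip (fun x => f x - f' x) (fun x => g x - g' x) = ip f g - ip f g' - ip f' g + ip f' g'.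
Proof.
move=> sf sf' sg sg'; rewrite ipBl//; last exact: sqintB.
by rewrite ipC [ip f' _]ipC !ipBl// ![ip g _]ipC ![ip g' _]ipC; ring.
Qed.

Lemma ipZl f g (a : R) : sqint f -> sqint g -> ip (fun x => a * f x) g = a * ip f g.
Proof.
move=> sf sg; have := ip_linl a 0 sf sf sg; rewrite mul0r addr0 => <-.
by apply: eq_Rintegral => x _; rewrite mul0r addr0.
Qed.

Lemma ip_suml I (r : seq I) (F : I -> T -> R) g : (forall i, sqint (F i)) -> sqint g ->
  ip (fun x => \sum_(i <- r) F i x) g = \sum_(i <- r) ip (F i) g.
Proof.
move=> sF sg; elim: r => [|i r ih].
  rewrite big_nil; transitivity (0 * ip g g); last by rewrite mul0r.
  rewrite -ipZl//.
  by apply: eq_Rintegral => x _; rewrite big_nil !mul0r.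
rewrite big_cons -ih -ipDl//; last exact: sqint_sum.
by apply: eq_Rintegral => x _; rewrite big_cons.
Qed.

Lemma ip_ge0 f : 0 <= ip f f.
Proof. by apply: Rintegral_ge0 => x _; rewrite -expr2 sqr_ge0. Qed.

Lemma ip_sq f : ip f f = \int[m]_x (f x ^+ 2).
Proof. by apply: eq_Rintegral => x _; rewrite expr2. Qed.

Lemma ip_sq_lin f g (a b : R) : sqint f -> sqint g ->
  ip (fun x => a * f x + b * g x) (fun x => a * f x + b * g x) =
  a ^+ 2 * ip f f + 2 * a * b * ip f g + b ^+ 2 * ip g g.
Proof.
move=> sf sg; have sh := sqint_lin a b sf sg.
rewrite ip_linl// [ip f _]ipC [ip g _]ipC !ip_linl// [ip g f]ipC; ring.
Qed.

Lemma ip_cs f g : sqint f -> sqint g -> ip f g ^+ 2 <= ip f f * ip g g.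
Proof.
move=> sf sg; have g0 := ip_ge0 g; have f0 := ip_ge0 f.
have h a b : 0 <= a ^+ 2 * ip f f + 2 * a * b * ip f g + b ^+ 2 * ip g g.
  by rewrite -ip_sq_lin// ip_ge0.
have [g00|gn0] := eqVneq (ip g g) 0; last first.
  have gp : 0 < ip g g by rewrite lt_def gn0.
  have := h (ip g g) (- ip f g).
  rewrite (_ : _ + _ = ip g g * (ip f f * ip g g - ip f g ^+ 2)); last by ring.
  by rewrite pmulr_rge0// subr_ge0.
(* If ip g g = 0, the quadratic form takes the value - (ip f g)^2 (ip f f + 2) at
   this point. *)
have := h (ip f g) (- (ip f f + 1)); rewrite g00; nra.
Qed.

Lemma ip_cs_sqrt f g : sqint f -> sqint g ->
  `|ip f g| <= Num.sqrt (ip f f) * Num.sqrt (ip g g).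
Proof.
move=> sf sg; rewrite -sqrtrM ?ip_ge0// -sqrtr_sqr ler_wsqrtr//.
exact: ip_cs.
Qed.

(** L^2 convergence in terms of inner products, so that limits are obtained by
    bilinearity and the Cauchy-Schwarz inequality. *)
Definition sqcvg (X : nat -> T -> R) (Y : T -> R) :=
  ip (fun x => X n x - Y x) (fun x => X n x - Y x) @[n --> \oo] --> (0 : R).

Lemma cvg_sqrt_ip X Y : sqcvg X Y ->
  Num.sqrt (ip (fun x => X n x - Y x) (fun x => X n x - Y x)) @[n --> \oo] --> (0:R).
Proof.
move=> XY; rewrite -(@sqrtr0 R); apply: continuous_cvg => //.
exact: sqrt_continuous.
Qed.

(** Expanding both arguments around their limits, the Cauchy-Schwarz inequality
    bounds each of the three error terms. *)
Lemma sqcvg_ip X Y X' Y' : (forall n, sqint (X n)) -> sqint Y ->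
  (forall n, sqint (X' n)) -> sqint Y' -> sqcvg X Y -> sqcvg X' Y' ->
  ip (X n) (X' n) @[n --> \oo] --> ip Y Y'.
Proof.
move=> sX sY sX' sY' XY XY'.
pose a n := Num.sqrt (ip (fun x => X n x - Y x) (fun x => X n x - Y x)).
pose b n := Num.sqrt (ip (fun x => X' n x - Y' x) (fun x => X' n x - Y' x)).
pose B n := a n * b n + Num.sqrt (ip Y Y) * b n + a n * Num.sqrt (ip Y' Y').
have B0 : B n @[n --> \oo] --> (0:R).
  have al := cvg_sqrt_ip XY; have bl := cvg_sqrt_ip XY'.
  rewrite [X in _ --> X](_ : _ = 0 * 0 + Num.sqrt (ip Y Y) * 0 + 0 * Num.sqrt (ip Y' Y')).
    apply: cvgD; first apply: cvgD; apply: cvgM => //; exact: cvg_cst.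
  by rewrite !mul0r mulr0 !addr0.
have key n : `|ip (X n) (X' n) - ip Y Y'| <= B n.
  have dX := sqintB (sX n) sY; have dX' := sqintB (sX' n) sY'.
  have -> : ip (X n) (X' n) - ip Y Y' =
     ip (fun x => X n x - Y x) (fun x => X' n x - Y' x) +
     ip Y (fun x => X' n x - Y' x) + ip (fun x => X n x - Y x) Y'.
    rewrite !ipBl// ![ip _ (fun x => X' n x - Y' x)]ipC !ipBl//.
    rewrite [ip (X' n) (X n)]ipC [ip (X' n) Y]ipC [ip Y' Y]ipC [ip Y' (X n)]ipC; ring.
  apply: le_trans (ler_normD _ _) _; apply: lerD; last exact: ip_cs_sqrt.
  by apply: le_trans (ler_normD _ _) _; apply: lerD; exact: ip_cs_sqrt.
apply/cvgrPdist_le => e e0; near=> n.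
rewrite distrC (le_trans (key n))//.
by near: n; apply: (cvgr_le 0) B0 _ e0.
Unshelve. all: by end_near. Qed.

Lemma sqcvg_lin X Y X' Y' (a b : R) : (forall n, sqint (X n)) -> sqint Y ->
  (forall n, sqint (X' n)) -> sqint Y' -> sqcvg X Y -> sqcvg X' Y' ->
  sqcvg (fun n x => a * X n x + b * X' n x) (fun x => a * Y x + b * Y' x).
Proof.
move=> sX sY sX' sY' XY XY'; rewrite /sqcvg.
have -> : (fun n => ip (fun x => a * X n x + b * X' n x - (a * Y x + b * Y' x))
    (fun x => a * X n x + b * X' n x - (a * Y x + b * Y' x))) =
  fun n => a ^+ 2 * ip (fun x => X n x - Y x) (fun x => X n x - Y x) +
   2 * a * b * ip (fun x => X n x - Y x) (fun x => X' n x - Y' x) +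
   b ^+ 2 * ip (fun x => X' n x - Y' x) (fun x => X' n x - Y' x).
  apply/funext => n; rewrite -ip_sq_lin; try exact: sqintB.
  by congr ip; apply/funext => x; ring.
have z0 : sqint (fun=> 0) := sqint0.
rewrite [X in _ --> X](_ : _ = a ^+ 2 * 0 + 2 * a * b * 0 + b ^+ 2 * 0); last by ring.
apply: cvgD; first apply: cvgD; apply: cvgM => //; try exact: cvg_cst.
have := @sqcvg_ip (fun n x => X n x - Y x) (fun=> 0) (fun n x => X' n x - Y' x) (fun=> 0)
  (fun n => sqintB (sX n) sY) z0 (fun n => sqintB (sX' n) sY') z0.
have -> : ip (fun=> 0) (fun=> 0) = 0.
  by rewrite /ip; under eq_Rintegral do rewrite mul0r; rewrite Rintegral_cst// mul0r.
by apply; rewrite /sqcvg; under eq_fun do under [fun x => _ - 0]eq_fun do rewrite subr0.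
Qed.

Lemma sqint_Lfun f : f \in Lfun m 2%:E -> sqint f.
Proof.
move=> f2; split; first by have := sub_Lfun_mfun f2; rewrite inE.
have /Lfun1_integrable := Lfun2_mul_Lfun1 f2 f2.
by apply: eq_integrable => // x _ /=; rewrite expr2.
Qed.

Lemma sqcvg_cvgLp X Y : cvgLp m 2 X Y ->
  [/\ forall n, sqint (X n), sqint Y & sqcvg X Y].
Proof.
move=> [LX LY XY].
have sX n : sqint (X n) := sqint_Lfun (LX n).
have sY := sqint_Lfun LY.
split => //.
have E n : ('N[m]_(2%:E)[EFin \o (X n \- Y)%R] `^ 2 =
    (ip (fun x => X n x - Y x) (fun x => X n x - Y x))%:E)%E.
  rewrite poweR_Lnorm// ip_sq /Rintegral fineK.
    by apply: eq_integral => x _ /=; rewrite powR_mulrn// real_normK ?num_real.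
  apply: integrable_fin_num => //.
  by have [] := sqintB (sX n) sY.
move/fine_cvgP : XY => [_ XY].
rewrite /sqcvg (_ : (fun n => _) =
    fun n => fine ('N[m]_(2%:E)[EFin \o (X n \- Y)%R])%E ^+ 2).
  rewrite [X in _ --> X](_ : _ = 0 ^+ 2); last by rewrite expr0n.
  by apply: (cvg_comp _ (fun z : R => z ^+ 2) XY); exact: exprn_continuous.
apply/funext => n; have := congr1 fine (E n).
by rewrite fine_poweR /= => <-; rewrite powR_mulrn// fine_ge0// Lnorm_ge0.
Qed.

End square_integrable.

(** * Gaussian fourth moments *)

Section density.
Import HBNNSimple.
Context d (T : measurableType d) {R : realType}.
Variables (m nu : {measure set T -> \bar R}) (g : T -> R).
Hypotheses (mg : measurable_fun setT g) (g0 : forall x, 0 <= g x).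
Hypothesis nuE : forall A, measurable A -> nu A = (\int[m]_(x in A) (g x)%:E)%E.
Local Open Scope ereal_scope.

(** Linearity gives the case of simple functions, monotone convergence the
    general one. *)
Lemma ge0_integral_density (f : T -> \bar R) : measurable_fun setT f ->
  (forall x, 0 <= f x) ->
  \int[nu]_x f x = \int[m]_x (f x * (g x)%:E).
Proof.
move=> mf f0; pose f_ := nnsfun_approx measurableT mf.
have mge : measurable_fun setT (fun x => (g x)%:E) by exact/measurable_EFinP.
have ge0 x : 0 <= (g x)%:E by rewrite lee_fin.
transitivity (limn (fun n => \int[nu]_x (f_ n x)%:E)).
  rewrite -monotone_convergence//.
  - apply: eq_integral => y _; apply/esym/cvg_lim => //.
    by apply: cvg_nnsfun_approx => // *; exact: f0.
  - by move=> n; exact/measurable_EFinP/measurable_funP.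
  - by move=> n y _; rewrite lee_fin.
  - by move=> y _ p n mn; rewrite lee_fin; exact/lefP/nd_nnsfun_approx.
rewrite [X in limn X](_ : _ = (fun n => \int[m]_x ((f_ n x)%:E * (g x)%:E))).
  rewrite -monotone_convergence//.
  - apply: eq_integral => y _; apply/cvg_lim => //.
    apply: cvgeZr => //.
    by apply: cvg_nnsfun_approx => // *; exact: f0.
  - move=> n; apply: emeasurable_funM => //.
    exact/measurable_EFinP/measurable_funP.
  - by move=> n y _; rewrite mule_ge0// lee_fin.
  - move=> y _ p n mn; rewrite lee_wpmul2r// lee_fin.
    exact/lefP/nd_nnsfun_approx.
apply/funext => n.
have mfn r : measurable (f_ n @^-1` [set r]) by exact: measurable_sfunP.
transitivity (\sum_(k \in range (f_ n)) \int[nu]_x (k * \1_(f_ n @^-1` [set k]) x)%:E).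
  under eq_integral do rewrite fimfunE -fsumEFin//.
  rewrite ge0_integral_fsum//.
  - by move=> y; exact/measurable_EFinP/measurable_funM.
  - by move=> y x _; rewrite nnfun_muleindic_ge0.
transitivity (\sum_(k \in range (f_ n))
    \int[m]_x ((k * \1_(f_ n @^-1` [set k]) x)%:E * (g x)%:E)); last first.
  rewrite -ge0_integral_fsum//.
  - apply: eq_integral => x _; rewrite [in RHS]fimfunE -fsumEFin//.
    rewrite ge0_mule_fsuml// => r; exact: nnfun_muleindic_ge0.
  - move=> r; apply: emeasurable_funM => //.
    exact/measurable_EFinP/measurable_funM.
  - by move=> r x _; rewrite mule_ge0// nnfun_muleindic_ge0.
apply: eq_fsbigr => r /[!inE] -[y _ ry].
have r0 : (0 <= r)%R by rewrite -ry.
under eq_integral do rewrite EFinM.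
under [RHS]eq_integral do rewrite EFinM -muleA.
rewrite !ge0_integralZl//.
- rewrite integral_indic// setIT nuE// integral_mkcond.
  congr (_ * _); apply: eq_integral => x _; rewrite patchE indicE.
  by case: ifP => _; rewrite ?mul1e ?mul0e.
- apply: emeasurable_funM => //; exact/measurable_EFinP.
- by move=> x _; rewrite mule_ge0// lee_fin.
- exact/measurable_EFinP.
Qed.
End density.

Section gaussian_moments.
Context d (Omega : measurableType d) {R : realType} (P : probability Omega R).
Notation mu := (@lebesgue_measure R).

(** The fourth moment identity of a centered Gaussian variable: applied to all
    linear combinations of a family, it determines the covariances of the
    squares. *)
Definition gauss4 (X : Omega -> R) := [/\ sqint P X, sqint P (fun w => X w ^+ 2) &
  ip P (fun w => X w ^+ 2) (fun w => X w ^+ 2) = 3 * ip P X X ^+ 2].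

Lemma integral_normal_law (X : Omega -> R) (s : R) (f : R -> R) :
  measurable_fun setT X ->
  (forall B : set R, measurable B -> P (X @^-1` B) = normal_prob 0 s B) ->
  measurable_fun setT f -> (forall x, 0 <= f x) ->
  (\int[P]_w (f (X w))%:E = \int[mu]_x (f x * normal_pdf 0 s x)%:E)%E.
Proof.
move=> mX XE mf f0.
transitivity (\int[normal_prob 0 s]_x (f x)%:E)%E; last first.
  under [RHS]eq_integral do rewrite EFinM.
  apply: (@ge0_integral_density _ _ _ mu (normal_prob 0 s) (normal_pdf 0 s)) => //.
  - exact: measurable_normal_pdf.
  - by move=> x; exact: normal_pdf_ge0.
  - exact/measurable_EFinP.
pose X' : Omega -> measurableTypeR R := X.
transitivity (\int[pushforward P X']_x (f x)%:E)%E.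
  rewrite ge0_integral_pushforward//.
  - exact/measurable_EFinP.
  - by move=> y _; rewrite lee_fin.
by apply: eq_measure_integral => A mA _; exact: XE.
Qed.

Lemma centered_gaussian_gauss4 X : centered_gaussian P X -> gauss4 X.
Proof.
move=> [mX HX].
have mXn n : measurable_fun setT (fun w => X w ^+ n) by exact: measurable_funX.
have [v [v0 I2 I4]] : exists v : R, [/\ 0 <= v,
    (\int[P]_w (X w ^+ 2)%:E = v%:E)%E &
    (\int[P]_w (X w ^+ 4)%:E = (3 * v ^+ 2)%:E)%E].
  case: HX => [X0|[s s0 XE]].
    exists 0; rewrite expr0n mulr0; split => //.
      rewrite (@ge0_ae_eq_integral _ _ _ P setT _ (cst 0%E)) ?integral0//.
      - exact/measurable_EFinP.
      - by move=> w _; rewrite lee_fin sqr_ge0.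
      - by apply: filterS X0 => w Xw _; rewrite Xw expr0n.
    rewrite (@ge0_ae_eq_integral _ _ _ P setT _ (cst 0%E)) ?integral0//.
    - exact/measurable_EFinP.
    - by move=> w _; rewrite lee_fin (exprM _ 2 2) sqr_ge0.
    - by apply: filterS X0 => w Xw _; rewrite Xw expr0n.
  exists (s ^+ 2); split; first exact: sqr_ge0.
    rewrite (integral_normal_law mX XE (f := fun x => x ^+ 2)) ?normal_moment2//.
    by move=> x; exact: sqr_ge0.
  rewrite (integral_normal_law mX XE (f := fun x => x ^+ 4)) ?normal_moment4 -?exprM//.
  by move=> x; rewrite (exprM _ 2 2) sqr_ge0.
split.
- split => //; apply/integrableP; split; first exact/measurable_EFinP.
  by under eq_integral do rewrite gee0_abs ?lee_fin ?sqr_ge0//; rewrite I2 ltry.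
- split => //; apply/integrableP; split.
    by apply/measurable_EFinP/measurable_funX.
  under eq_integral do rewrite gee0_abs ?lee_fin ?sqr_ge0// -exprM.
  by rewrite I4 ltry.
- rewrite !ip_sq /Rintegral I2 /=.
  by under eq_integral do rewrite -exprM; rewrite I4.
Qed.

(** Polarization: E (X + Y)^4 + E (X - Y)^4 involves E X^2 Y^2, and the fourth
    moment identity expresses every other term by second moments. *)
Lemma ip_sqr_sqr X Y : gauss4 X -> gauss4 Y ->
  gauss4 (fun w => X w + Y w) -> gauss4 (fun w => X w - Y w) ->
  ip P (fun w => X w ^+ 2) (fun w => Y w ^+ 2) =
  ip P X X * ip P Y Y + 2 * ip P X Y ^+ 2.
Proof.
move=> [sX sX2 eX] [sY sY2 eY] [sD sD2 eD] [sB sB2 eB].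
pose S w := X w ^+ 2 + Y w ^+ 2; pose Q w := 2 * (X w * Y w).
have sS : sqint P S by exact: sqintD.
have sQ : sqint P Q.
  by apply: sqint_ext (sqintB sD2 sS) => w; rewrite /S /Q; ring.
have D2 : (fun w => (X w + Y w) ^+ 2) = fun w => 1 * S w + 1 * Q w.
  by apply/funext => w; rewrite /S /Q; ring.
have B2 : (fun w => (X w - Y w) ^+ 2) = fun w => 1 * S w + (-1) * Q w.
  by apply/funext => w; rewrite /S /Q; ring.
move: eD eB; rewrite D2 B2 !ip_sq_lin//.
have -> : (fun w => X w + Y w) = fun w => 1 * X w + 1 * Y w.
  by apply/funext => w; ring.
have -> : (fun w => X w - Y w) = fun w => 1 * X w + (-1) * Y w.
  by apply/funext => w; ring.
rewrite !ip_sq_lin//.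
have QE : ip P Q Q = 4 * ip P (fun w => X w ^+ 2) (fun w => Y w ^+ 2).
  rewrite -ipZl//; apply: eq_Rintegral => w _; rewrite /Q; ring.
have SE : ip P S S = ip P (fun w => X w ^+ 2) (fun w => X w ^+ 2) +
    2 * ip P (fun w => X w ^+ 2) (fun w => Y w ^+ 2) +
    ip P (fun w => Y w ^+ 2) (fun w => Y w ^+ 2).
  have := ip_sq_lin 1 1 sX2 sY2; rewrite !expr1n !mulr1 !mul1r => <-.
  by apply: eq_Rintegral => w _; rewrite /S; ring.
rewrite QE SE eX eY.
move: (ip P S Q) (ip P X X) (ip P X Y) (ip P Y Y) (ip P _ _) => a b c e f h1 h2; lra.
Qed.

Lemma Rintegral_prob_cst (c : R) : \int[P]_w c = c.
Proof. by rewrite Rintegral_cst//= probability_setT /= mulr1. Qed.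

Lemma sqint_cst (c : R) : sqint P (fun=> c).
Proof.
by split => //; exact: finite_measure_integrable_cst.
Qed.

(** The variance of the sum of squares comes from [ip_sqr_sqr], the last term is
    the squared mean of Y. *)
Lemma wick_variance (I : Type) (r : seq I) (X : I -> Omega -> R) (c : R) :
  (forall i, gauss4 (X i)) ->
  (forall i j, gauss4 (fun w => X i w + X j w)) ->
  (forall i j, gauss4 (fun w => X i w - X j w)) ->
  let Y w := \sum_(i <- r) X i w ^+ 2 - c in
  sqint P Y /\
  ip P Y Y = 2 * (\sum_(i <- r) \sum_(j <- r) ip P (X i) (X j) ^+ 2) +
    (\sum_(i <- r) ip P (X i) (X i) - c) ^+ 2.
Proof.
move=> gX gD gB Y.
have s2 i : sqint P (fun w => X i w ^+ 2) by have [] := gX i.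
have sS := sqint_sum r s2.
have sc := sqint_cst c.
split; first exact: sqintB.
have sY : sqint P Y by exact: sqintB.
have i1 i : ip P (fun=> c) (fun w => X i w ^+ 2) = c * ip P (X i) (X i).
  rewrite ip_sq -RintegralZl//; have [[_ ?] _ _] := gX i => //.
pose S w := \sum_(i <- r) X i w ^+ 2.
have cc : ip P (fun=> c) (fun=> c) = c ^+ 2 by rewrite /ip Rintegral_prob_cst expr2.
have Sc : ip P S (fun=> c) = c * \sum_(i <- r) ip P (X i) (X i).
  rewrite /S ip_suml// big_distrr/=; apply: eq_bigr => i _.
  by rewrite ipC i1.
have SS : ip P S S = \sum_(i <- r) \sum_(j <- r)
    (ip P (X i) (X i) * ip P (X j) (X j) + 2 * ip P (X i) (X j) ^+ 2).
  rewrite {1}/S ip_suml//; apply: eq_bigr => i _.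
  rewrite ipC ip_suml//; apply: eq_bigr => j _.
  by rewrite ipC ip_sqr_sqr.
rewrite (_ : Y = fun w => 1 * S w + (-1) * c); last first.
  by apply/funext => w; rewrite /Y /S; ring.
rewrite (ip_sq_lin 1 (-1) sS sc) cc Sc SS.
under eq_bigr do rewrite big_split/= -!big_distrr/=.
rewrite big_split/= -big_distrl -big_distrr/=; ring.
Qed.

End gaussian_moments.

(** * Wiener integrals and their quadratic variation *)

Lemma mem_spacetime (R : realType) (T t s y : R) : t <= T ->
  s \in `[0, t]%classic -> ((s, y) \in spacetime T) = (y \in `[0, 1[%classic).
Proof.
move=> tT; rewrite inE/= in_itv/= => /andP[s0 st].
by apply/idP/idP; rewrite !inE /spacetime /= ?in_itv/= s0 (le_trans st tT);
  [case|split].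
Qed.

Section white_noise.
Context d (Omega : measurableType d) {R : realType} (P : probability Omega R).
Variables (T : R) (W : set (R * R) -> Omega -> R).
Hypothesis hW : white_noise P T W.
Notation lam := (@lebesgue2 R).

Lemma measurable_spacetime : measurable (spacetime T).
Proof. by apply: measurableX; exact: measurable_itv. Qed.

Lemma lebesgue2_spacetime_lty : (lam (spacetime T) < +oo)%E.
Proof.
have -> : lam (spacetime T) =
    (@lebesgue_measure R `[0%R, T]%classic * @lebesgue_measure R `[0%R, 1%R[%classic)%E.
  by apply: product_measure1E; exact: measurable_itv.
rewrite !lebesgue_measure_itv/= !lte_fin ltr01; case: ifP => _.
  by rewrite -!EFinB -EFinM ltry.
by rewrite mul0e ltry.
Qed.

Definition region (A : set (R * R)) := measurable A /\ A `<=` spacetime T.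

Lemma sqint_indic A : region A -> sqint lam (\1_A : R * R -> R).
Proof.
move=> [mA sA]; split; first exact: measurable_indic.
under eq_fun do rewrite indicE -natrX.
have -> : (fun x => ((x \in A) ^ 2)%:R%:E) = EFin \o (\1_A : R * R -> R).
  by apply/funext => x /=; rewrite indicE; case: (x \in A).
apply/integrableP; split; first by apply/measurable_EFinP; exact: measurable_indic.
under eq_integral do rewrite /= ger0_norm//.
rewrite integral_indic// setIT; apply: le_lt_trans lebesgue2_spacetime_lty.
by apply: le_measure => //; rewrite inE//; exact: measurable_spacetime.
Qed.

Lemma ip_indic A B : region A -> region B ->
  (ip lam (\1_A : R * R -> R) \1_B)%:E = lam (A `&` B).
Proof.
move=> [mA sA] [mB sB].
have mAB := measurableI _ _ mA mB.
rewrite /ip /Rintegral.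
have -> : (\int[lam]_x ((\1_A x : R) * \1_B x)%:E = lam (A `&` B))%E.
  rewrite -(setIT (A `&` B)) -integral_indic//; apply: eq_integral => x _.
  by rewrite indicI.
rewrite fineK// ge0_fin_numE//; apply: le_lt_trans lebesgue2_spacetime_lty.
apply: le_measure; rewrite ?inE//; first exact: measurable_spacetime.
by move=> x [/sA].
Qed.

Lemma admissible_cons p s : admissible T (p :: s) <-> region p.2 /\ admissible T s.
Proof.
split=> [h|[hp hs] q].
  split; first by apply: h; rewrite mem_head.
  by move=> q qs; apply: h; rewrite in_cons qs orbT.
by rewrite in_cons => /orP[/eqP ->|/hs].
Qed.

Lemma admissible_cat s s' : admissible T s -> admissible T s' -> admissible T (s ++ s').
Proof. by move=> hs hs' p; rewrite mem_cat => /orP[/hs|/hs']. Qed.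

Definition scale_steps (a : R) (s : seq (R * set (R * R))) :=
  [seq (a * p.1, p.2) | p <- s].

Lemma admissible_scale a s : admissible T s -> admissible T (scale_steps a s).
Proof. by move=> hs p /mapP[q /hs hq ->]. Qed.

Lemma sum_noise_lin a b s s' w :
  sum_noise W (scale_steps a s ++ scale_steps b s') w =
  a * sum_noise W s w + b * sum_noise W s' w.
Proof.
rewrite /sum_noise big_cat/= !big_map/= !big_distrr/=.
by congr (_ + _); apply: eq_bigr => p _; rewrite mulrA.
Qed.

Lemma sum_noise_gauss4 s : admissible T s -> gauss4 P (sum_noise W s).
Proof. by move=> /(hW.1 _) /centered_gaussian_gauss4. Qed.

Lemma sum_noise_sqint s : admissible T s -> sqint P (sum_noise W s).
Proof. by case/sum_noise_gauss4. Qed.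

Lemma noise_sqint A : region A -> sqint P (W A).
Proof.
move=> rA; have : admissible T [:: (1, A)] by apply/admissible_cons; split.
move/sum_noise_sqint; apply: sqint_ext => w.
by rewrite /sum_noise big_seq1 mul1r.
Qed.

Lemma sum_indic_sqint s : admissible T s -> sqint lam (sum_indic s).
Proof.
elim: s => [_|p s ih /admissible_cons[rp /ih hs]].
  by apply: sqint_ext (sqint0 _) => z; rewrite /sum_indic big_nil.
apply: sqint_ext (sqintD (sqintZ p.1 (sqint_indic rp)) hs) => z.
by rewrite /sum_indic big_cons.
Qed.

Lemma ip_sum_noise s g : admissible T s -> sqint P g ->
  ip P (sum_noise W s) g = \sum_(p <- s) p.1 * ip P (W p.2) g.
Proof.
move=> + sg; elim: s => [_|p s ih /admissible_cons[rp hs]].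
  rewrite big_nil; transitivity (0 * ip P g g); last by rewrite mul0r.
  by rewrite -ipZl//; apply: eq_Rintegral => w _; rewrite /sum_noise big_nil !mul0r.
have sW := noise_sqint rp.
rewrite big_cons -ih// -ipZl// -ipDl//; last 2 first.
- exact: sqintZ.
- exact: sum_noise_sqint.
by apply: eq_Rintegral => w _; rewrite /sum_noise big_cons.
Qed.

Lemma ip_sum_indic s g : admissible T s -> sqint lam g ->
  ip lam (sum_indic s) g = \sum_(p <- s) p.1 * ip lam \1_(p.2) g.
Proof.
move=> + sg; elim: s => [_|p s ih /admissible_cons[rp hs]].
  rewrite big_nil; transitivity (0 * ip lam g g); last by rewrite mul0r.
  by rewrite -ipZl//; apply: eq_Rintegral => w _; rewrite /sum_indic big_nil !mul0r.
have sW := sqint_indic rp.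
rewrite big_cons -ih// -ipZl// -ipDl//; last 2 first.
- exact: sqintZ.
- exact: sum_indic_sqint.
by apply: eq_Rintegral => w _; rewrite /sum_indic big_cons.
Qed.

(** Bilinearity reduces the identity to indicators, where it is the covariance of
    the noise. *)
Lemma step_isometry s s' : admissible T s -> admissible T s' ->
  ip P (sum_noise W s) (sum_noise W s') = ip lam (sum_indic s) (sum_indic s').
Proof.
move=> hs hs'; have sn' := sum_noise_sqint hs'; have si' := sum_indic_sqint hs'.
rewrite ip_sum_noise// ip_sum_indic//.
apply: eq_big_seq => p ps; have rp : region p.2 := hs p ps.
congr (_ * _); rewrite ipC [RHS]ipC ip_sum_noise ?ip_sum_indic//; last 2 first.
- exact: sqint_indic.
- exact: noise_sqint.
apply: eq_big_seq => q qs; have rq : region q.2 := hs' q qs.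
congr (_ * _); apply: EFin_inj; rewrite ip_indic//.
have := hW.2 _ _ rq.1 rq.2 rp.1 rp.2; rewrite unlock => <-.
rewrite /ip /Rintegral fineK//; apply: integrable_fin_num => //.
by apply: sqint_mul; exact: noise_sqint.
Qed.

Lemma wiener_isometry h h' X X' :
  wiener_integral P T W h X -> wiener_integral P T W h' X' ->
  [/\ sqint P X, sqint lam (h \_ (spacetime T)) &
   ip P X X' = ip lam (h \_ (spacetime T)) (h' \_ (spacetime T))].
Proof.
move=> [s [as_ /sqcvg_cvgLp[sI sh cI] /sqcvg_cvgLp[sN sX cN]]].
move=> [s' [as'_ /sqcvg_cvgLp[sI' sh' cI'] /sqcvg_cvgLp[sN' sX' cN']]].
split => //.
have c1 := sqcvg_ip sN sX sN' sX' cN cN'.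
have c2 := sqcvg_ip sI sh sI' sh' cI cI'.
move: c2; rewrite (_ : (fun n => ip lam _ _) =
    fun n => ip P (sum_noise W (s n)) (sum_noise W (s' n))).
  by move=> c2; exact: (cvg_unique _ c1 c2).
by apply/funext => n; rewrite step_isometry.
Qed.

Section quadratic_variation.
Variables (h : nat -> R * R -> R) (Z : nat -> Omega -> R).
Hypothesis hZ : forall i, wiener_integral P T W (h i) (Z i).

Let D i w := Z i.+1 w - Z i w.
Let K i z := (h i.+1 \_ (spacetime T)) z - (h i \_ (spacetime T)) z.

Lemma increments_isometry i j : ip P (D i) (D j) = ip lam (K i) (K j).
Proof.
have iso i' j' := (wiener_isometry (hZ i') (hZ j')).
have sZ i' : sqint P (Z i') by have [] := iso i' i'.
have sh i' : sqint lam (h i' \_ (spacetime T)) by have [] := iso i' i'.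
have sD : sqint P (D j) by exact: sqintB.
have sK : sqint lam (K j) by exact: sqintB.
have E i' j' : ip P (Z i') (Z j') = ip lam (h i' \_ (spacetime T)) (h j' \_ (spacetime T)).
  by have [] := iso i' j'.
rewrite /D /K !ipBl// ipC [ip P (Z i) _]ipC [ip lam (h i.+1 \_ _) _]ipC.
by rewrite [ip lam (h i \_ _) _]ipC !ipBl// !E.
Qed.

(** Expansion of 0 <= E (|X| - eta)^2. Leaving eta free avoids square roots until the
    end, where all errors are balanced at once. *)
Lemma Rintegral_norm_le (X : Omega -> R) (eta : R) : sqint P X -> 0 < eta ->
  2 * eta * \int[P]_w `|X w| <= eta ^+ 2 + ip P X X.
Proof.
move=> sX e0; have sA := sqint_norm sX.
have := ip_ge0 P (fun w => 1 * `|X w| + (- eta) * (fun=> 1) w).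
rewrite ip_sq_lin//; last exact: sqint_cst.
have -> : ip P (fun w => `|X w|) (fun=> 1) = \int[P]_w `|X w|.
  by apply: eq_Rintegral => w _; rewrite mulr1.
have -> : ip P (fun=> 1) (fun=> 1) = 1 by rewrite /ip Rintegral_prob_cst mulr1.
have -> : ip P (fun w => `|X w|) (fun w => `|X w|) = ip P X X.
  by apply: eq_Rintegral => w _; rewrite -!expr2 real_normK ?num_real.
move: (ip _ _ _) (\int[P]_w _) => a b; nra.
Qed.

Lemma sqint_integrable (X : Omega -> R) : sqint P X -> P.-integrable setT (EFin \o X).
Proof.
move=> sX; have := sqint_mul sX (sqint_cst P 1).
by apply: eq_integrable => // w _ /=; rewrite mulr1.
Qed.

(** Squares are continuous from L^2 to L^1, by
    |x^2 - y^2| <= |x - y|^2 + 2 |x - y| |y|. *)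
Lemma Rintegral_dist_sqr (X Y : Omega -> R) : sqint P X -> sqint P Y ->
  \int[P]_w `|X w ^+ 2 - Y w ^+ 2| <=
  ip P (fun w => X w - Y w) (fun w => X w - Y w) +
  2 * Num.sqrt (ip P Y Y) * Num.sqrt (ip P (fun w => X w - Y w) (fun w => X w - Y w)).
Proof.
move=> sX sY; have sB := sqintB sX sY.
pose A w := `|X w - Y w|; pose B w := `|Y w|.
have sA : sqint P A := sqint_norm sB; have sBY : sqint P B := sqint_norm sY.
have normE (f : Omega -> R) : ip P (fun w => `|f w|) (fun w => `|f w|) = ip P f f.
  by apply: eq_Rintegral => w _; rewrite -!expr2 real_normK ?num_real.
have : \int[P]_w `|X w ^+ 2 - Y w ^+ 2| <= \int[P]_w (1 * (A w * A w) + 2 * (A w * B w)).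
  have iA := integrableZl measurableT 1 (sqint_mul sA sA).
  have iB := integrableZl measurableT 2 (sqint_mul sA sBY).
  apply: le_Rintegral => //.
  - apply: integrable_norm.
    have := integrableB measurableT (sqint_mul sX sX) (sqint_mul sY sY).
    by apply: eq_integrable => // w _ /=; rewrite !expr2.
  - exact: (integrableD measurableT iA iB).
  - move=> w _; rewrite subr_sqr normrM mul1r -/(A w).
    have : `|X w + Y w| <= A w + 2 * B w.
      rewrite (_ : X w + Y w = (X w - Y w) + 2 * Y w); last by ring.
      by apply: le_trans (ler_normD _ _) _; rewrite normrM ger0_norm.
    by move=> /(ler_wpM2l (normr_ge0 (X w - Y w))) /le_trans; apply; rewrite -/(A w); lra.
move=> /le_trans; apply.
rewrite RintegralD//; last 2 first.
- exact: (integrableZl measurableT 1 (sqint_mul sA sA)).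
- exact: (integrableZl measurableT 2 (sqint_mul sA sBY)).
rewrite !RintegralZl ?sqint_mul// mul1r -/(ip P A A) -/(ip P A B) normE lerD2l.
rewrite -mulrA ler_pM2l// mulrC -[X in Num.sqrt X * _]normE -[X in _ * Num.sqrt X]normE.
by apply: le_trans (ler_norm _) _; exact: ip_cs_sqrt.
Qed.

Lemma cvg_sumr (r : seq nat) (f : nat -> nat -> R) (l : nat -> R) :
  (forall i, f i n @[n --> \oo] --> l i) ->
  \sum_(i <- r) f i n @[n --> \oo] --> \sum_(i <- r) l i.
Proof.
move=> fl; elim: r => [|i r ih].
  by under eq_fun do rewrite big_nil; rewrite big_nil; exact: cvg_cst.
by under eq_fun do rewrite big_cons; rewrite big_cons; exact: cvgD.
Qed.

Lemma Rintegral_sumr (r : seq nat) (F : nat -> Omega -> R) :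
  (forall i, P.-integrable setT (EFin \o F i)) ->
  P.-integrable setT (EFin \o (fun w => \sum_(i <- r) F i w)) /\
  \int[P]_w (\sum_(i <- r) F i w) = \sum_(i <- r) \int[P]_w F i w.
Proof.
move=> iF; elim: r => [|i r [ih1 ih2]].
  rewrite big_nil; split.
    by apply: eq_integrable (integrable0 _ _) => // w _ /=; rewrite big_nil.
  by under eq_Rintegral do rewrite big_nil; rewrite Rintegral_prob_cst.
split.
  by apply: eq_integrable (integrableD measurableT (iF i) ih1) => // w _ /=; rewrite big_cons.
rewrite big_cons -ih2 -RintegralD//.
by apply: eq_Rintegral => w _; rewrite big_cons.
Qed.

(** An L^1 bound on the distance between a sum of squared increments and a constant
    c, in terms of the kernels only. For step functions it follows from
    [wick_variance] and [Rintegral_norm_le]; both sides are continuous for L^2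
    convergence. *)
Lemma wiener_qv_bound (r : seq nat) (c eta : R) : 0 < eta ->
  2 * eta * \int[P]_w `|\sum_(i <- r) D i w ^+ 2 - c| <=
  eta ^+ 2 + (2 * (\sum_(i <- r) \sum_(j <- r) ip lam (K i) (K j) ^+ 2) +
    (\sum_(i <- r) ip lam (K i) (K i) - c) ^+ 2).
Proof.
move=> e0.
have [s sP] := choice hZ.
have as_ i n : admissible T (s i n) by have [+ _ _] := sP i; exact.
have sZ i : sqint P (Z i) by have [] := wiener_isometry (hZ i) (hZ i).
have cZ i : sqcvg P (fun n => sum_noise W (s i n)) (Z i).
  by have [_ _ /sqcvg_cvgLp[]] := sP i.
have sN i n : sqint P (sum_noise W (s i n)) := sum_noise_sqint (as_ i n).
have sD i : sqint P (D i) by exact: sqintB.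
pose X i n w := 1 * sum_noise W (s i.+1 n) w + (-1) * sum_noise W (s i n) w.
have sX i n : sqint P (X i n) by exact: sqint_lin.
pose q i n := scale_steps 1 (s i.+1 n) ++ scale_steps (-1) (s i n).
have aq i n : admissible T (q i n).
  by apply: admissible_cat; apply: admissible_scale.
have Xq i n : X i n = sum_noise W (q i n).
  by apply/funext => w; rewrite sum_noise_lin.
have cX i : sqcvg P (X i) (D i).
  have -> : D i = fun w => 1 * Z i.+1 w + (-1) * Z i w.
    by apply/funext => w; rewrite /D; ring.
  exact: sqcvg_lin.
have gX i n : gauss4 P (X i n) by rewrite Xq; exact: sum_noise_gauss4.
have gLin (a b : R) i j n : gauss4 P (fun w => a * X i n w + b * X j n w).
  rewrite (_ : (fun w => _) = sum_noise W (scale_steps a (q i n) ++ scale_steps b (q j n))).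
    by apply/sum_noise_gauss4/admissible_cat; exact: admissible_scale.
  by apply/funext => w; rewrite sum_noise_lin !Xq.
have gD i j n : gauss4 P (fun w => X i n w + X j n w).
  by have := gLin 1 1 i j n; under eq_fun do rewrite !mul1r.
have gB i j n : gauss4 P (fun w => X i n w - X j n w).
  by have := gLin 1 (-1) i j n; under eq_fun do rewrite mul1r mulN1r.
pose V n := 2 * (\sum_(i <- r) \sum_(j <- r) ip P (X i n) (X j n) ^+ 2) +
    (\sum_(i <- r) ip P (X i n) (X i n) - c) ^+ 2.
pose E i n := ip P (fun w => X i n w - D i w) (fun w => X i n w - D i w).
pose F i n := E i n + 2 * Num.sqrt (ip P (D i) (D i)) * Num.sqrt (E i n).
have step n : 2 * eta * \int[P]_w `|\sum_(i <- r) D i w ^+ 2 - c| <=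
    2 * eta * \sum_(i <- r) F i n + (eta ^+ 2 + V n).
  have [sY VE] := wick_variance r c (fun i => gX i n) (fun i j => gD i j n)
    (fun i j => gB i j n).
  rewrite /V -VE.
  apply: le_trans (lerD (lexx _) (Rintegral_norm_le sY e0)).
  rewrite -mulrDr ler_pM2l ?mulr_gt0//.
  have iY := integrable_norm (sqint_integrable sY).
  have iF i : P.-integrable setT (EFin \o (fun w => `|X i n w ^+ 2 - D i w ^+ 2|)).
    apply: integrable_norm.
    have := integrableB measurableT (sqint_mul (sX i n) (sX i n)) (sqint_mul (sD i) (sD i)).
    by apply: eq_integrable => // w _ /=; rewrite !expr2.
  have [iS SE] := Rintegral_sumr r iF.
  have iD i : P.-integrable setT (EFin \o (fun w => D i w ^+ 2)) := (sD i).2.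
  have [iSD _] := Rintegral_sumr r iD.
  apply: (@le_trans _ _ (\int[P]_w (\sum_(i <- r) `|X i n w ^+ 2 - D i w ^+ 2| +
      `|\sum_(i <- r) X i n w ^+ 2 - c|))).
    apply: le_Rintegral => //.
    - apply: integrable_norm.
      exact: (integrableB measurableT iSD (finite_measure_integrable_cst P c measurableT)).
    - exact: (integrableD measurableT iS iY).
    - move=> w _; rewrite -[leLHS]normrN opprB.
      rewrite (_ : c - _ = \sum_(i <- r) (X i n w ^+ 2 - D i w ^+ 2) -
        (\sum_(i <- r) X i n w ^+ 2 - c)); last by rewrite sumrB; ring.
      apply: le_trans (ler_normB _ _) _; rewrite lerD2r; exact: ler_norm_sum.
  rewrite RintegralD// SE lerD2r; apply: ler_sum => i _.
  exact: Rintegral_dist_sqr.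
have Vl : V n @[n --> \oo] --> 2 * (\sum_(i <- r) \sum_(j <- r) ip P (D i) (D j) ^+ 2) +
    (\sum_(i <- r) ip P (D i) (D i) - c) ^+ 2.
  have cc i j : ip P (X i n) (X j n) @[n --> \oo] --> ip P (D i) (D j).
    exact: sqcvg_ip.
  have sq (f : nat -> R) (l : R) : f n @[n --> \oo] --> l -> f n ^+ 2 @[n --> \oo] --> l ^+ 2.
    by move=> fl; apply: (cvg_comp _ (fun z : R => z ^+ 2) fl); exact: exprn_continuous.
  apply: cvgD.
    apply: cvgM; first exact: cvg_cst.
    apply: cvg_sumr => i; apply: cvg_sumr => j; apply: sq; exact: cc.
  apply: sq; apply: cvgB; last exact: cvg_cst.
  by apply: cvg_sumr => i; exact: cc.
have Fl : \sum_(i <- r) F i n @[n --> \oo] --> (0:R).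
  rewrite [X in _ --> X](_ : _ = \sum_(i <- r) (0:R)); last by rewrite big1.
  apply: cvg_sumr => i.
  rewrite [X in _ --> X](_ : _ = 0 + 2 * Num.sqrt (ip P (D i) (D i)) * 0); last first.
    by rewrite mulr0 addr0.
  apply: cvgD; first exact: cX.
  by apply: cvgM; [exact: cvg_cst|exact: cvg_sqrt_ip (cX i)].
have lim : 2 * eta * \sum_(i <- r) F i n + (eta ^+ 2 + V n) @[n --> \oo] -->
   2 * eta * 0 + (eta ^+ 2 + (2 * (\sum_(i <- r) \sum_(j <- r) ip P (D i) (D j) ^+ 2) +
    (\sum_(i <- r) ip P (D i) (D i) - c) ^+ 2)).
  apply: cvgD; first by apply: cvgM => //; exact: cvg_cst.
  by apply: cvgD => //; exact: cvg_cst.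
have := cvgr_to_ge lim (nearW _ step).
rewrite mulr0 add0r.
have -> : \sum_(i <- r) ip P (D i) (D i) = \sum_(i <- r) ip lam (K i) (K i).
  by apply: eq_bigr => i _; rewrite increments_isometry.
have -> : \sum_(i <- r) \sum_(j <- r) ip P (D i) (D j) ^+ 2 =
    \sum_(i <- r) \sum_(j <- r) ip lam (K i) (K j) ^+ 2.
  by apply: eq_bigr => i _; apply: eq_bigr => j _; rewrite increments_isometry.
by apply; exact: _.
Qed.

End quadratic_variation.
End white_noise.

(** * Increments of the convolution kernel *)

Section convolution_kernel.
Context {R : realType}.
Notation mu := (@lebesgue_measure R).
Notation lam := (@lebesgue2 R).

Definition conv_kernel (eps t x : R) (z : R * R) : R :=
  \1_(`[0, t]) z.1 * heat_kernel (eps * (t - z.1)) (x - z.2).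

Lemma integral_lebesgue2 (f : R * R -> \bar R) : measurable_fun setT f ->
  (forall z, 0 <= f z)%E ->
  (\int[lam]_z f z = \int[mu]_s \int[mu]_y f (s, y))%E.
Proof. by move=> mf f0; have := @fubini_tonelli1 _ _ _ _ R mu mu f mf f0. Qed.

(** For each s the space integral is given by [heat_kernel_conv], which doubles
    eps. At s = t both sides of the inner identity vanish. *)
Lemma ip_conv_kernel (T eps t x x' : R) : 0 < eps -> 0 < t -> t <= T ->
  sqint lam (conv_kernel eps t x \_ (spacetime T)) ->
  sqint lam (conv_kernel eps t x' \_ (spacetime T)) ->
  (ip lam (conv_kernel eps t x \_ (spacetime T)) (conv_kernel eps t x' \_ (spacetime T)))%:E =
  heat_cov (2 * eps) t (x - x').
Proof.
move=> eps0 t0 tT sx sx'.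
rewrite /ip /Rintegral fineK; last first.
  by apply: integrable_fin_num => //; exact: sqint_mul.
pose k (s y : R) := (heat_kernel (eps * (t - s)) (x - y) *
  heat_kernel (eps * (t - s)) (x' - y))%:E.
have k0 s y : (0 <= k s y)%E by rewrite lee_fin mulr_ge0 ?heat_kernel_ge0.
have E s y : ((conv_kernel eps t x \_ (spacetime T)) (s, y) *
   (conv_kernel eps t x' \_ (spacetime T)) (s, y))%:E =
   if s \in `[0, t]%classic then (if y \in `[0, 1[%classic then k s y else 0%E) else 0%E.
  rewrite !patchE /conv_kernel /=.
  have [st|st] := boolP (s \in `[0, t]%classic); last first.
    by rewrite !indicE (negbTE st) !mul0r !if_same mulr0.
  have [y1|y1] := boolP (y \in `[0, 1[%classic).
    rewrite mem_set; last first.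
      move: st y1; rewrite !inE /spacetime /= !in_itv/= => /andP[-> st] ->; split => //.
      exact: le_trans st tT.
    by rewrite !indicE st !mul1r.
  rewrite memNset ?mulr0//.
  by move: y1; rewrite notin_setE /spacetime /= => y1 [_].
rewrite integral_lebesgue2; last 2 first.
- by apply/measurable_EFinP; apply: measurable_funM; [exact: sx.1|exact: sx'.1].
- by move=> [s y]; rewrite E; case: ifP => // _; case: ifP.
rewrite /heat_cov [RHS]integral_mkcond; apply: eq_integral => s _.
rewrite patchE; under eq_integral do rewrite E.
case: ifP => st; last by rewrite integral0.
have <- : (\int[mu]_(y in `[0%R, 1%R[) k s y = eheat (2 * eps * (t - s)) (x - x'))%E.
  have : s <= t by move: st; rewrite inE/= in_itv/= => /andP[].
  rewrite le_eqVlt => /predU1P[->|st'].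
    rewrite subrr !mulr0 eheat0// integral0_eq// => y _.
    rewrite /k subrr mulr0; congr (_%:E).
    suff -> : heat_kernel 0 (x - y) = 0 by rewrite mul0r.
    by apply: EFin_inj; rewrite heat_kernelE eheat0.
  rewrite -mulrA -heat_kernel_conv// mulr_gt0// subr_gt0//.
by rewrite [RHS]integral_mkcond; apply: eq_integral => y _; rewrite patchE.
Qed.

(** With N h = L, the N diagonal terms add up to L / a + O(h); the N^2 error terms of
    size h^4 are negligible with respect to the N diagonal terms of size h^2. *)
Lemma increment_cov_sums (N : nat) (h a C L : R) (kap : nat -> nat -> R) :
  0 <= h <= 1 -> N%:R * h = L -> L <= 1 -> 0 < a -> 0 <= C ->
  (forall i j, (i < N)%N -> (j < N)%N -> exists2 D, 0 <= D <= C * h ^+ 2 &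
     kap i j = ((if i == j then h else 0) - D) / a) ->
  `|\sum_(0 <= i < N) kap i i - L / a| <= C * h / a /\
  \sum_(0 <= i < N) \sum_(0 <= j < N) kap i j ^+ 2 <= 2 * (1 + C ^+ 2) * h / a ^+ 2.
Proof.
move=> /andP[h0 h1] NL L1 a0 C0 kapE.
have a20 : 0 < a ^+ 2 by rewrite exprn_gt0.
have N0 : 0 <= N%:R :> R by [].
split.
  rewrite -NL -mulrA.
  have -> : N%:R * (h / a) = \sum_(0 <= i < N) (h / a) :> R.
    by rewrite sumr_const_nat subn0 mulr_natl.
  rewrite -sumrB; apply: le_trans (ler_norm_sum _ _ _) _.
  apply: (@le_trans _ _ (\sum_(0 <= i < N) (C * h ^+ 2 / a))).
    apply: ler_sum_nat => i /= iN; have [D /andP[D0 DC] ->] := kapE i i iN iN.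
    rewrite eqxx -mulrBl addrAC subrr add0r normrM normrN !ger0_norm ?invr_ge0 ?(ltW a0)//.
    by rewrite ler_pM2r// invr_gt0.
  rewrite sumr_const_nat subn0 -mulr_natl.
  rewrite (_ : _ * _ = C * (N%:R * h) * h / a); last by ring.
  rewrite ler_pM2r ?invr_gt0// ler_wpM2r// NL ler_piMr//.
apply: (@le_trans _ _ (\sum_(0 <= i < N) \sum_(0 <= j < N)
   (2 * (if i == j then h ^+ 2 else 0) + 2 * C ^+ 2 * h ^+ 4) / a ^+ 2)).
  apply: ler_sum_nat => i /= iN; apply: ler_sum_nat => j /= jN.
  have [D /andP[D0 DC] ->] := kapE i j iN jN.
  rewrite expr_div_n ler_pM2r ?invr_gt0//.
  have DD : D ^+ 2 <= C ^+ 2 * h ^+ 4.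
    by rewrite (exprM h 2 2) -exprMn lerXn2r// nnegrE// mulr_ge0// sqr_ge0.
  by case: ifP => _; nra.
have -> : \sum_(0 <= i < N) \sum_(0 <= j < N)
   (2 * (if i == j then h ^+ 2 else 0) + 2 * C ^+ 2 * h ^+ 4) / a ^+ 2 =
   \sum_(0 <= i < N) (2 * h ^+ 2 + N%:R * (2 * C ^+ 2 * h ^+ 4)) / a ^+ 2.
  apply: eq_big_nat => i /= iN; rewrite -mulr_suml big_split/=; congr (_ / _).
  congr (_ + _); last by rewrite sumr_const_nat subn0 [RHS]mulr_natl.
  rewrite -big_distrr/=; congr (_ * _).
  rewrite -big_mkcond/= (eq_bigl (fun j => j == i)); last by move=> j; rewrite eq_sym.
  by rewrite big_nat1_eq iN.
rewrite sumr_const_nat subn0 -[_ *+ N]mulr_natl mulrA ler_pM2r ?invr_gt0//.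
have -> : N%:R * (2 * h ^+ 2 + N%:R * (2 * C ^+ 2 * h ^+ 4)) =
  2 * (N%:R * h) * h + 2 * C ^+ 2 * (N%:R * h) ^+ 2 * h ^+ 2 by ring.
rewrite NL.
have L0 : 0 <= L by rewrite -NL mulr_ge0.
have LL : L ^+ 2 * h ^+ 2 <= h.
  have : L ^+ 2 <= 1 by rewrite expr_le1.
  have : h ^+ 2 <= h by rewrite expr2 ler_piMr.
  by have := sqr_ge0 L; nra.
have : L * h <= h by rewrite ler_piMl.
have := sqr_ge0 C; nra.
Qed.

End convolution_kernel.

(** * Lipschitz estimates and second moments *)

Section kernel_estimates.
Context {R : realType}.
Notation mu := (@lebesgue_measure R).
Notation lam := (@lebesgue2 R).

(** Half of the exponent is spent to absorb the factor b + a coming from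
    b^2 - a^2 = (b - a) (b + a). *)
Lemma expRN_sqr_diff (a b : R) : 0 <= a <= b ->
  expR (- a ^+ 2) - expR (- b ^+ 2) <= 4 * (b - a) * expR (- (a ^+ 2 / 2)).
Proof.
move=> /andP[a0 ab].
have -> : expR (- a ^+ 2) - expR (- b ^+ 2) =
    expR (- (a ^+ 2 / 2)) * (expR (- (a ^+ 2 / 2)) * (1 - expR (- (b ^+ 2 - a ^+ 2)))).
  rewrite mulrBr mulr1 mulrBr -!expRD; congr (expR _ - expR _); by field.
rewrite mulrC ler_pM2r ?expR_gt0//.
set e := expR (- (a ^+ 2 / 2)); set q := expR (- (b ^+ 2 - a ^+ 2)).
have e0 : 0 < e := expR_gt0 _.
have q0 : 0 < q := expR_gt0 _.
have e1 : e * (1 + a ^+ 2 / 2) <= 1.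
  apply: (@le_trans _ _ (e * expR (a ^+ 2 / 2))).
    by rewrite ler_pM2l// expR_ge1Dx.
  by rewrite /e expRN mulVf// gt_eqF ?expR_gt0.
have e2 : e <= 1 by apply: le_trans e1; rewrite ler_peMr ?(ltW e0)// lerDl divr_ge0 ?sqr_ge0.
have q1 : 1 - q <= b ^+ 2 - a ^+ 2.
  by have := expR_ge1Dx (- (b ^+ 2 - a ^+ 2)); rewrite -/q; lra.
(* For b - a > 1 the left-hand side is at most 1; otherwise b + a <= 2 a + 1, and
   e * (2 a + 1) <= 4. *)
have [ba1|ba1] := leP (b - a) 1; last first.
  apply: (@le_trans _ _ 1); last by lra.
  have qle1 : q <= 1 by rewrite -expR0 ler_expR oppr_le0 subr_ge0 lerXn2r// nnegrE; lra.
  by apply: mulr_ile1; rewrite ?(ltW e0)//; lra.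
have : e * (1 - q) <= e * ((b - a) * (2 * a + 1)).
  rewrite ler_pM2l//; apply: le_trans q1 _; nra.
move=> /le_trans; apply.
have : e * (2 * a + 1) <= 4.
  have : 2 * a + 1 <= 4 * (1 + a ^+ 2 / 2) by have := sqr_ge0 (a - 1); nra.
  by move=> /(ler_wpM2l (ltW e0)); lra.
by move=> H; rewrite mulrCA [X in _ <= X]mulrC ler_wpM2l//; lra.
Qed.

Definition gaussk_lip : R := 4 * Num.sqrt 2 * Num.sqrt pi.

Lemma gaussk_lip_ge0 : 0 <= gaussk_lip.
Proof. by rewrite !mulr_ge0. Qed.

(** [expRN_sqr_diff] rescaled: the factor [gaussk r 0] is of order r^(-1/2) and half
    of the exponent remains as a kernel at time 2 r. *)
Lemma gaussk_sub_le r (a b : R) : `|a| <= `|b| ->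
  gaussk r a - gaussk r b <= gaussk_lip * `|a - b| * gaussk r 0 * gaussk (2 * r) a.
Proof.
move=> ab; have [r0|r0] := leP r 0.
  rewrite /gaussk [Num.sqrt (_ * r)]ler0_sqrtr ?invr0 ?mul0r ?mulr0 ?mul0r ?subrr//.
  by rewrite mulr_ge0_le0// mulr_ge0// pi_ge0.
pose q := Num.sqrt (4 * r).
have q0 : 0 < q by rewrite sqrtr_gt0 mulr_gt0.
have q2 : q ^+ 2 = 4 * r by rewrite sqr_sqrtr// mulr_ge0// ltW.
have p0 : 0 < Num.sqrt pi :> R by rewrite sqrtr_gt0 pi_gt0.
have s20 : 0 < Num.sqrt 2 :> R by rewrite sqrtr_gt0.
have E x : - x ^+ 2 / (4 * r) = - (`|x| / q) ^+ 2.
  by rewrite expr_div_n real_normK ?num_real// q2 mulNr.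
have qE : Num.sqrt (4 * pi * r) = Num.sqrt pi * q.
  by rewrite -sqrtrM ?pi_ge0//; congr Num.sqrt; ring.
have q2E : Num.sqrt (4 * pi * (2 * r)) = Num.sqrt 2 * (Num.sqrt pi * q).
  rewrite -qE -sqrtrM ?ler0n//; congr Num.sqrt; ring.
rewrite /gaussk qE q2E !E.
have -> : - a ^+ 2 / (4 * (2 * r)) = - ((`|a| / q) ^+ 2 / 2).
  rewrite expr_div_n real_normK ?num_real// q2; by field; exact: lt0r_neq0.
have : 0 <= `|a| / q <= `|b| / q.
  by rewrite divr_ge0 ?(ltW q0)//= ler_pM2r ?invr_gt0.
move=> /expRN_sqr_diff; rewrite normr0 mul0r expr0n/= oppr0 expR0 mulr1.
rewrite -mulrBr; set e := expR (- (_ / 2)); move=> H.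
have e0 : 0 < e := expR_gt0 _.
have dab : `|b| / q - `|a| / q <= `|a - b| / q.
  by rewrite -mulrBl ler_pM2r ?invr_gt0// distrC; exact: lerB_dist.
have H2 : 4 * (`|b| / q - `|a| / q) * e <= 4 * (`|a - b| / q) * e.
  by rewrite ler_pM2r// ler_pM2l.
have := le_trans H H2.
rewrite -(@ler_pM2l _ (Num.sqrt pi * q)^-1) ?invr_gt0 ?mulr_gt0// => /le_trans; apply.
rewrite /gaussk_lip le_eqVlt; apply/orP; left; apply/eqP.
by move: (Num.sqrt pi) (Num.sqrt 2) p0 s20 => p s p0 s0; field; rewrite !lt0r_neq0.
Qed.

Lemma gaussk_mono r (x y : R) : `|x| <= `|y| -> gaussk r y <= gaussk r x.
Proof.
move=> xy; have [r0|r0] := leP r 0.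
  rewrite /gaussk !ler0_sqrtr ?invr0 ?mul0r//.
  by rewrite mulr_ge0_le0// mulr_ge0// pi_ge0.
rewrite /gaussk ler_wpM2l ?invr_ge0// ler_expR ler_pM2r ?invr_gt0 ?mulr_gt0//.
rewrite lerN2 -(real_normK (num_real x)) -(real_normK (num_real y)).
by rewrite lerXn2r ?nnegrE.
Qed.

(** The kernel being even and decreasing in |x|, the larger value is the one at the
    point nearest to 0. *)
Lemma gaussk_dist_le r (a b : R) :
  `|gaussk r a - gaussk r b| <=
  gaussk_lip * `|a - b| * gaussk r 0 * (gaussk (2 * r) a + gaussk (2 * r) b).
Proof.
have c0 := gaussk_lip_ge0; have g0 := gaussk_ge0 r 0.
have ga := gaussk_ge0 (2 * r) a; have gb := gaussk_ge0 (2 * r) b.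
have k0 : 0 <= gaussk_lip * `|a - b| * gaussk r 0 by rewrite !mulr_ge0.
have [ab|ba] := leP `|a| `|b|.
  have h1 := gaussk_sub_le r ab.
  have h2 : gaussk r b <= gaussk r a by exact: gaussk_mono.
  rewrite ger0_norm ?subr_ge0//; apply: le_trans h1 _.
  by rewrite ler_wpM2l// lerDl.
have h1 := gaussk_sub_le r (ltW ba).
have h2 : gaussk r a <= gaussk r b by apply: gaussk_mono; exact: ltW.
rewrite distrC ger0_norm ?subr_ge0//; apply: le_trans h1 _.
by rewrite distrC ler_wpM2l// lerDr.
Qed.

(** A one-sided inequality without subtraction is summed over the integers in the
    extended reals; the absolute value is recovered by exchanging x and x'. *)
Lemma heat_kernel_le_add s (C x x' : R) :
  0 <= C ->
  (forall a b : R, `|a - b| = `|x - x'| ->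
     gaussk s a <= gaussk s b + C * (gaussk (2 * s) a + gaussk (2 * s) b)) ->
  heat_kernel s x <= heat_kernel s x' + C * (heat_kernel (2 * s) x + heat_kernel (2 * s) x').
Proof.
move=> C0 h; rewrite -lee_fin EFinD EFinM EFinD !heat_kernelE /eheat.
have g0 r y k : (0 <= (gaussk r (y - k%:~R))%:E)%E by rewrite lee_fin gaussk_ge0.
rewrite -esumD; [|by move=> k _; exact: g0|by move=> k _; exact: g0].
have gg k : (0 <= (gaussk (2 * s) (x - k%:~R))%:E + (gaussk (2 * s) (x' - k%:~R))%:E)%E.
  by rewrite adde_ge0.
rewrite -esum_intZl// -esumD; last 2 first.
- by move=> k _; exact: g0.
- by move=> k _; rewrite mule_ge0// lee_fin.
apply: le_esum => k _; rewrite -(EFinD (gaussk (2 * s) _)) -EFinM -EFinD lee_fin.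
by apply: h; congr (`|_|); ring.
Qed.

Lemma heat_kernel_dist_le s (x x' : R) :
  `|heat_kernel s x - heat_kernel s x'| <= gaussk_lip * `|x - x'| * gaussk s 0 *
    (heat_kernel (2 * s) x + heat_kernel (2 * s) x').
Proof.
have C0 : 0 <= gaussk_lip * `|x - x'| * gaussk s 0.
  by rewrite !mulr_ge0 ?gaussk_lip_ge0 ?gaussk_ge0.
have H (a b : R) : `|a - b| = `|x - x'| ->
    gaussk s a <= gaussk s b +
      gaussk_lip * `|x - x'| * gaussk s 0 * (gaussk (2 * s) a + gaussk (2 * s) b).
  by move=> <-; have := gaussk_dist_le s a b; rewrite ler_norml => /andP[_]; rewrite lerBlDl.
have h1 := heat_kernel_le_add C0 H.
have h2 : heat_kernel s x' <= heat_kernel s x + gaussk_lip * `|x - x'| * gaussk s 0 *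
    (heat_kernel (2 * s) x' + heat_kernel (2 * s) x).
  apply: heat_kernel_le_add => // a b.
  by rewrite distrC [in RHS]distrC distrC => /H; rewrite distrC.
rewrite ler_norml; apply/andP; split; last by rewrite lerBlDl.
by move: h2; rewrite [heat_kernel _ x' + heat_kernel _ x]addrC; lra.
Qed.

Section jensen.
Context d (Omega : measurableType d) (P : probability Omega R).
Context d' (T : measurableType d') (m : {sigma_finite_measure set T -> \bar R}).
Local Open Scope ereal_scope.

(** The square as the supremum of its tangents: Y^2 / M is the maximum over l of
    2 l Y - l^2 M, attained at l = Y / M. *)
Lemma sqr_le_of_tangent (M : R) (Y Q : \bar R) : (0 < M)%R -> 0 <= Y -> 0 <= Q ->
  (forall l : R, (0 <= l)%R -> (2 * l)%:E * Y <= (l ^+ 2 * M)%:E + Q) ->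
  Y * Y <= M%:E * Q.
Proof.
move=> M0; case: Q => [q||]//; last first.
  by move=> Y0 _ _; rewrite gt0_muley ?lte_fin// leey.
case: Y => [y||]//; last first.
  move=> _ q0 /(_ 1%R ler01); rewrite mulr1 gt0_muley ?lte_fin//.
rewrite !lee_fin => y0 q0 h.
have := h (y / M)%R; rewrite -EFinM -EFinD lee_fin divr_ge0 ?(ltW M0)// => /(_ isT).
have -> : ((y / M) ^+ 2 * M = y * y / M)%R by field; exact: lt0r_neq0.
have -> : (2 * (y / M) * y = y * y / M + y * y / M)%R by field; exact: lt0r_neq0.
rewrite lerD2l ler_pdivrMr// => /le_trans; apply; by rewrite mulrC.
Qed.

(** Jensen's inequality for the measure of density k, followed by an exchange of
    integrals. The tangent inequality 2 l G <= l^2 + G^2 is integrated, so that Y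
    may be infinite. *)
Lemma second_moment_integral (k : T -> R) (G : T * Omega -> R) (M K : R) :
  measurable_fun setT k -> (forall z, 0 <= k z)%R ->
  measurable_fun setT G -> (forall z, 0 <= G z)%R ->
  (0 < M)%R -> \int[m]_z (k z)%:E <= M%:E ->
  (forall z, \int[P]_w (G (z, w) ^+ 2)%:E <= K%:E) ->
  let Y w := \int[m]_z (k z * G (z, w))%:E in
  measurable_fun setT Y /\ \int[P]_w (Y w * Y w) <= (M ^+ 2 * K)%:E.
Proof.
move=> mk k0 mG G0 M0 kM GK Y.
have mk' : measurable_fun setT (fun zw : T * Omega => k zw.1).
  exact: measurableT_comp.
have mY : measurable_fun setT Y.
  apply: (@measurable_fun_fubini_tonelli_G _ _ _ _ R m
    (fun zw => (k zw.1 * G zw)%:E)) => //.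
  - by apply/measurable_EFinP; exact: measurable_funM.
  - by move=> zw; rewrite lee_fin mulr_ge0.
split => //.
pose Q w := \int[m]_z (k z * G (z, w) ^+ 2)%:E.
have mkG2 : measurable_fun setT (fun zw : T * Omega => (k zw.1 * G zw ^+ 2)%:E).
  by apply/measurable_EFinP; apply: measurable_funM => //; exact: measurable_funX.
have mQ : measurable_fun setT Q.
  apply: (@measurable_fun_fubini_tonelli_G _ _ _ _ R m
    (fun zw => (k zw.1 * G zw ^+ 2)%:E)) => //.
  by move=> zw; rewrite lee_fin mulr_ge0// sqr_ge0.
have Y0 w : 0 <= Y w by apply: integral_ge0 => z _; rewrite lee_fin mulr_ge0.
have Q0 w : 0 <= Q w by apply: integral_ge0 => z _; rewrite lee_fin mulr_ge0// sqr_ge0.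
have mGw w : measurable_fun setT (fun z => G (z, w)) by exact: measurable_fun_pair1.
have YQ w : Y w * Y w <= M%:E * Q w.
  apply: sqr_le_of_tangent => // l l0.
  rewrite -ge0_integralZl//; last 3 first.
  - by apply/measurable_EFinP; apply: measurable_funM.
  - by move=> z _; rewrite lee_fin mulr_ge0.
  - by rewrite lee_fin mulr_ge0.
  apply: (@le_trans _ _ (\int[m]_z ((l ^+ 2)%:E * (k z)%:E + (k z * G (z, w) ^+ 2)%:E))).
    apply: ge0_le_integral => //.
    - by move=> z _; rewrite -EFinM lee_fin !mulr_ge0.
    - by apply: measurable_funeM; apply/measurable_EFinP; apply: measurable_funM.
    - apply: emeasurable_funD; first by apply: measurable_funeM; exact/measurable_EFinP.
      by apply/measurable_EFinP; apply: measurable_funM => //; exact: measurable_funX.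
    - move=> z _; rewrite -!EFinM -EFinD lee_fin -subr_ge0.
      rewrite (_ : _ - _ = k z * (l - G (z, w)) ^+ 2)%R; last by ring.
      by rewrite mulr_ge0// sqr_ge0.
  rewrite ge0_integralD//.
  - rewrite leeD2r// ge0_integralZl ?lee_fin ?sqr_ge0//.
    + by rewrite (EFinM (l ^+ 2)%R M) lee_wpmul2l// lee_fin sqr_ge0.
    + exact/measurable_EFinP.
    + by move=> z _; rewrite lee_fin.
  - by move=> z _; rewrite -EFinM lee_fin mulr_ge0// sqr_ge0.
  - by apply: measurable_funeM; exact/measurable_EFinP.
  - by move=> z _; rewrite lee_fin mulr_ge0// sqr_ge0.
  - by apply/measurable_EFinP; apply: measurable_funM => //; exact: measurable_funX.
apply: (@le_trans _ _ (\int[P]_w (M%:E * Q w))).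
  apply: ge0_le_integral => //.
  - by move=> w _; rewrite mule_ge0.
  - exact: emeasurable_funM.
  - exact: measurable_funeM.
rewrite ge0_integralZl// ?lee_fin ?(ltW M0)//.
have -> : \int[P]_w Q w = \int[m]_z ((k z)%:E * \int[P]_w (G (z, w) ^+ 2)%:E).
  rewrite /Q -(@fubini_tonelli _ _ _ _ R m P (fun zw => (k zw.1 * G zw ^+ 2)%:E))//.
    apply: eq_integral => z _ /=; rewrite -ge0_integralZl//.
    - apply/measurable_EFinP; apply: measurable_funX; exact: measurable_fun_pair2.
    - by move=> w _; rewrite lee_fin sqr_ge0.
    - by rewrite lee_fin.
  by move=> zw; rewrite lee_fin mulr_ge0// sqr_ge0.
rewrite expr2 -mulrA EFinM lee_wpmul2l ?lee_fin ?(ltW M0)//.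
apply: (@le_trans _ _ (\int[m]_z (K%:E * (k z)%:E))).
  apply: ge0_le_integral => //.
  - move=> z _; rewrite mule_ge0 ?lee_fin// integral_ge0// => w _.
    by rewrite lee_fin sqr_ge0.
  - apply: emeasurable_funM; first exact/measurable_EFinP.
    apply: (@measurable_fun_fubini_tonelli_F _ _ _ _ R P (fun zw => (G zw ^+ 2)%:E)).
      by apply/measurable_EFinP; exact: measurable_funX.
    by move=> zw; rewrite lee_fin sqr_ge0.
  - by apply: measurable_funeM; exact/measurable_EFinP.
  - by move=> z _; rewrite muleC lee_wpmul2r// lee_fin.
have K0 : (0 <= K)%R.
  rewrite -lee_fin; apply: le_trans (GK point).
  by apply: integral_ge0 => w _; rewrite lee_fin sqr_ge0.
rewrite ge0_integralZl//.
- by rewrite mulrC EFinM lee_wpmul2l ?lee_fin.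
- exact/measurable_EFinP.
- by move=> z _; rewrite lee_fin.
Qed.

End jensen.
End kernel_estimates.

(** * The drift term *)

Section drift_term.
Context d (Omega : measurableType d) {R : realType} (P : probability Omega R).
Notation mu := (@lebesgue_measure R).
Notation lam := (@lebesgue2 R).
Variables (T eps t : R).
Hypotheses (eps0 : 0 < eps) (t0 : 0 < t) (tT : t <= T).

(** The common form of the convolution kernel (g = 1, c = eps) and of the two terms
    that dominate its difference quotients (g s of order (t - s)^(-1/2),
    c = 2 eps). *)
Definition weighted_kernel (g : R -> R) (c x : R) (z : R * R) : R :=
  \1_(`[0, t]) z.1 * (g z.1 * heat_kernel (c * (t - z.1)) (x - z.2)).

Lemma measurable_weighted_kernel (g : R -> R) (c x : R) : measurable_fun setT g ->
  measurable_fun setT (weighted_kernel g c x \_ (spacetime T)).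
Proof.
move=> mg; apply/(measurable_restrictT _ _).1; first exact: measurable_spacetime.
apply: measurable_funTS; apply: measurable_funM.
  by apply: (measurableT_comp _ measurable_fst); apply: measurable_indic; exact: measurable_itv.
apply: measurable_funM; first exact: (measurableT_comp mg measurable_fst).
apply: measurable_heat_kernel.
  by apply: measurable_funM => //; apply: measurable_funB.
by apply: measurable_funB.
Qed.

Lemma weighted_kernel_ge0 (g : R -> R) (c x : R) z : (forall s, 0 <= g s) ->
  0 <= (weighted_kernel g c x \_ (spacetime T)) z.
Proof.
move=> g0; rewrite patchE; case: ifP => // _.
by rewrite mulr_ge0// mulr_ge0// heat_kernel_ge0.
Qed.

Lemma integral_eheat_le1 r (x : R) : (\int[mu]_(y in `[0%R, 1%R[) eheat r (x - y) <= 1)%E.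
Proof.
have [r0|r0] := leP r 0; last by rewrite integral_eheat.
by rewrite integral0_eq// => y _; rewrite eheat0.
Qed.

(** The heat kernel has mass at most 1 in space. *)
Lemma integral_weighted_kernel (g : R -> R) (c x : R) :
  measurable_fun setT g -> (forall s, 0 <= g s) ->
  (\int[lam]_z ((weighted_kernel g c x \_ (spacetime T)) z)%:E <=
   \int[mu]_(s in `[0%R, t]) (g s)%:E)%E.
Proof.
move=> mg g0; rewrite integral_lebesgue2; last 2 first.
- by apply/measurable_EFinP; exact: measurable_weighted_kernel.
- by move=> z; rewrite lee_fin weighted_kernel_ge0.
rewrite [leRHS]integral_mkcond; apply: ge0_le_integral => //.
- by move=> s _; apply: integral_ge0 => y _; rewrite lee_fin weighted_kernel_ge0.
- apply: (@measurable_fun_fubini_tonelli_F _ _ _ _ R mu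
    (fun z => ((weighted_kernel g c x \_ (spacetime T)) z)%:E)).
    by apply/measurable_EFinP; exact: measurable_weighted_kernel.
  by move=> z; rewrite lee_fin weighted_kernel_ge0.
- apply/(measurable_restrictT _ _).1; first exact: measurable_itv.
  by apply/measurable_funTS/measurable_EFinP.
move=> s _; rewrite patchE; case: ifPn => st; last first.
  rewrite integral0_eq// => y _; rewrite patchE; case: ifP => // _.
  by rewrite /weighted_kernel/= indicE (negbTE st) mul0r.
have -> : (\int[mu]_y ((weighted_kernel g c x \_ (spacetime T)) (s, y))%:E =
    \int[mu]_(y in `[0%R, 1%R[) ((g s)%:E * eheat (c * (t - s)) (x - y)))%E.
  rewrite [RHS]integral_mkcond; apply: eq_integral => y _; rewrite !patchE.
  rewrite (mem_spacetime y tT st); case: ifP => _; last by rewrite ?mulr0.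
  by rewrite /weighted_kernel/= indicE st mul1r EFinM heat_kernelE.
rewrite ge0_integralZl//.
- by rewrite -[leRHS]mule1 lee_wpmul2l ?lee_fin// integral_eheat_le1.
- by apply: measurable_funTS; apply: measurable_eheat => //; exact: measurable_funB.
- by move=> y _; exact: eheat_ge0.
- by rewrite lee_fin.
Qed.

Variable u : R -> R -> Omega -> R.
Hypothesis measurable_u_joint : measurable_fun (spacetime T `*` [set: Omega])
    (fun z : (R * R) * Omega => u z.1.1 z.1.2 z.2).
Hypothesis hmom : bounded_moments P T u.

(** The reaction term, extended by 0 to a function that is measurable everywhere. *)
Definition reaction : (R * R) * Omega -> R :=
  (fun zw => allen_cahn (u zw.1.1 zw.1.2 zw.2)) \_ (spacetime T `*` [set: Omega]).

Lemma measurable_reaction : measurable_fun setT reaction.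
Proof.
apply/(measurable_restrictT _ _).1.
  by apply: measurableX => //; exact: measurable_spacetime.
by apply: measurable_funB => //; exact: measurable_funX.
Qed.

Lemma reactionE z w : reaction (z, w) =
  if z \in spacetime T then allen_cahn (u z.1 z.2 w) else 0.
Proof.
rewrite /reaction patchE; congr (if _ then _ else _).
by apply/idP/idP; rewrite !inE /= => -[].
Qed.

Lemma moment_bound (n : nat) : (1 < n)%N -> exists2 S : R, 0 <= S &
  forall z, spacetime T z -> (\int[P]_w (`|u z.1 z.2 w| ^+ n)%:E <= S%:E)%E.
Proof.
move=> n1; have n2 : 2 <= n%:R :> R by rewrite ler_nat.
have := hmom n2; set E := [set _ | _ in _] => Efin.
have ub z : spacetime T z -> (\int[P]_w (`|u z.1 z.2 w| ^+ n)%:E <= ereal_sup E)%E.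
  move=> zT; apply: ereal_sup_ubound; exists z => //.
  by rewrite unlock; apply: eq_integral => w _; rewrite powR_mulrn.
have E0 : (0 <= ereal_sup E)%E.
  apply: le_trans (ub (0, 0) _).
    by apply: integral_ge0 => w _; rewrite lee_fin exprn_ge0.
  by split; rewrite /= in_itv/= ?lexx ?ltr01//= (le_trans (ltW t0) tT).
exists (fine (ereal_sup E)); first exact: fine_ge0.
by rewrite fineK// ge0_fin_numE.
Qed.

Lemma measurable_u z : spacetime T z -> measurable_fun setT (u z.1 z.2).
Proof.
move=> zT.
have mU : measurable_fun setT ((fun zw : (R * R) * Omega => u zw.1.1 zw.1.2 zw.2)
    \_ (spacetime T `*` [set: Omega])).
  apply/(measurable_restrictT _ _).1 => //.
  by apply: measurableX => //; exact: measurable_spacetime.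
have := measurable_fun_pair2 z mU.
by apply: eq_measurable_fun => w _; rewrite patchE mem_set.
Qed.

(** |v - v^3|^2 <= 2 v^2 + 2 v^6. *)
Lemma reaction_moment : exists2 K : R, 0 <= K &
  forall z, (\int[P]_w (`|reaction (z, w)| ^+ 2)%:E <= K%:E)%E.
Proof.
have [S2 S20 h2] := @moment_bound 2 isT; have [S6 S60 h6] := @moment_bound 6 isT.
exists (2 * S2 + 2 * S6); first by rewrite addr_ge0// mulr_ge0.
move=> z; have [zT|zT] := boolP (z \in spacetime T); last first.
  rewrite integral0_eq ?lee_fin ?addr_ge0 ?mulr_ge0// => w _.
  by rewrite reactionE (negbTE zT) normr0 expr0n.
have zT' : spacetime T z by rewrite inE in zT.
have mz := measurable_u zT'.
have mzn n : measurable_fun setT (fun w => (`|u z.1 z.2 w| ^+ n)%:E).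
  by apply/measurable_EFinP; apply: measurable_funX; exact: measurableT_comp.
apply: (@le_trans _ _ (\int[P]_w (2%:E * (`|u z.1 z.2 w| ^+ 2)%:E +
   2%:E * (`|u z.1 z.2 w| ^+ 6)%:E))%E).
  apply: ge0_le_integral => //.
  - apply/measurable_EFinP; apply: measurable_funX; apply: measurableT_comp => //.
    by apply: measurable_fun_pair2; exact: measurable_reaction.
  - by apply: emeasurable_funD; exact: measurable_funeM.
  - move=> w _; rewrite -!EFinM -EFinD lee_fin reactionE zT /allen_cahn.
    move: (u _ _ _) => v; rewrite -!normrX !ger0_norm ?sqr_ge0//; last first.
      by rewrite (exprM v 3 2) sqr_ge0.
    rewrite -subr_ge0 (_ : _ - _ = (v + v ^+ 3) ^+ 2); first exact: sqr_ge0.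
    by ring.
rewrite ge0_integralD//; [|exact: measurable_funeM..].
have sc n S : (\int[P]_w (`|u z.1 z.2 w| ^+ n)%:E <= S%:E)%E ->
    (\int[P]_w (2%:E * (`|u z.1 z.2 w| ^+ n)%:E) <= 2%:E * S%:E)%E.
  move=> hS; by rewrite ge0_integralZl//; rewrite lee_wpmul2l.
rewrite (EFinD (2 * S2)) (EFinM 2 S2) (EFinM 2 S6).
by apply: leeD; apply: sc; [exact: h2|exact: h6].
Qed.


Lemma sigma_finite_lebesgue2 :
  sigma_finite [set: measurableTypeR R * measurableTypeR R] (@lebesgue2 R).
Proof.
pose I (n : nat) : set R := `[- n%:R, n%:R]%classic.
have inI (v : R) (n : nat) : `|v| <= n%:R -> I n v.
  by rewrite /I /= in_itv/= ler_norml.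
exists (fun n => I n `*` I n).
  apply/seteqP; split => // -[x y] _; exists (Num.truncn (Num.max `|x| `|y|)).+1 => //.
  have := ltW (Num.Theory.truncnS_gt (Num.max `|x| `|y|)); rewrite ge_max => /andP[hx hy].
  by split; exact: inI.
move=> n; have mI : measurable (I n) by exact: measurable_itv.
split; first exact: measurableX.
have -> : lebesgue2 (I n `*` I n) = (@lebesgue_measure R (I n) * @lebesgue_measure R (I n))%E.
  exact: product_measure1E.
have fI : (@lebesgue_measure R (I n)) \is a fin_num.
  by rewrite /I lebesgue_measure_itv/=; case: ifP.
by rewrite -ge0_fin_numE ?fin_numM// mule_ge0.
Qed.

(** The same measure, packaged with its sigma-finiteness for the exchange of
    integrals. *)
Definition lebesgue2_sf :
    {sigma_finite_measure set (measurableTypeR R * measurableTypeR R)%type -> \bar R} :=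
  HB.pack_for (SigmaFiniteMeasure.type (measurableTypeR R * measurableTypeR R)%type R)
    (Measure.sort (@lebesgue2 R))
    (@Measure_isSigmaFinite.Build _ _ _ (Measure.sort (@lebesgue2 R)) sigma_finite_lebesgue2).

Let H x : R * R -> R := conv_kernel eps t x \_ (spacetime T).

Lemma conv_kernelE x : H x = weighted_kernel (cst 1) eps x \_ (spacetime T).
Proof. by congr patch; apply/funext => z; rewrite /conv_kernel /weighted_kernel mul1r. Qed.

Lemma measurable_conv_kernel x : measurable_fun setT (H x).
Proof. by rewrite conv_kernelE; exact: measurable_weighted_kernel. Qed.

Definition drift x w : R :=
  \int[mu]_(s in `[0%R, t]) (\int[mu]_(y in `[0%R, 1%R[)
    (heat_kernel (eps * (t - s)) (x - y) * allen_cahn (u s y w))).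

Lemma measurable_reaction_section w : measurable_fun setT (fun z => reaction (z, w)).
Proof. by apply: measurable_fun_pair1; exact: measurable_reaction. Qed.

(** The nested real-valued integrals agree with the integral over space-time by
    Fubini's theorem. The inner integral may be infinite for some s, where its
    real value is not the integral; these s form a null set. *)
Lemma driftE x w :
  lam.-integrable setT (fun z => (H x z * reaction (z, w))%:E) ->
  drift x w = \int[lam]_z (H x z * reaction (z, w)).
Proof.
move=> iF; pose f z := (H x z * reaction (z, w))%:E.
have iF' : ((@lebesgue_measure R) \x (@lebesgue_measure R))%E.-integrable setT f := iF.
rewrite /drift /Rintegral; congr fine.
have -> : (\int[lam]_z (H x z * reaction (z, w))%:E = \int[mu]_s \int[mu]_y f (s, y))%E.
  by rewrite (@integral12_prod_meas1 _ _ _ _ R mu mu f iF').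
transitivity (\int[mu]_s (fine (\int[mu]_y f (s, y)))%:E)%E; last first.
  apply: ae_eq_integral => //.
  - apply/measurable_EFinP; apply: measurableT_comp => //.
    exact: (@measurable_fubini_F _ _ _ _ R mu mu f iF').
  - exact: (@measurable_fubini_F _ _ _ _ R mu mu f iF').
  - have := @ae_integrable1 _ _ _ _ R mu mu f iF'.
    apply: filterS => s /= ifs _; rewrite fineK//.
    by apply: integrable_fin_num.
rewrite integral_mkcond; apply: eq_integral => s _; rewrite patchE.
case: ifPn => st; last first.
  rewrite integral0_eq// => y _; rewrite /f /H patchE; case: ifP => _; rewrite ?mul0r//.
  by rewrite /conv_kernel/= indicE (negbTE st) !mul0r.
congr ((fine _)%:E); rewrite integral_mkcond; apply: eq_integral => y _.
rewrite !patchE /f reactionE /H patchE.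
have [y1|y1] := boolP (y \in `[0, 1[%classic).
  rewrite mem_set; last first.
    move: st y1; rewrite !inE /spacetime /= !in_itv/= => /andP[-> st] ->; split => //.
    exact: le_trans st tT.
  by rewrite /conv_kernel/= indicE st mul1r.
rewrite memNset ?mulr0//.
by move: y1; rewrite notin_setE /spacetime /= => y1 [_].
Qed.

Let g (s : R) : R := gaussk_lip * gaussk (eps * (t - s)) 0.

(** An integrable bound on the difference quotients of the convolution kernel. *)
Let dist_kernel x x' z : R := (weighted_kernel g (2 * eps) x \_ (spacetime T)) z +
  (weighted_kernel g (2 * eps) x' \_ (spacetime T)) z.

Let g0 s : 0 <= g s.
Proof. by rewrite mulr_ge0 ?gaussk_lip_ge0 ?gaussk_ge0. Qed.

Let mg : measurable_fun setT g.
Proof.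
apply: measurable_funM => //; apply: measurable_gaussk => //.
by apply: measurable_funM => //; exact: measurable_funB.
Qed.

Let dist_kernel_ge0 x x' z : 0 <= dist_kernel x x' z.
Proof. by rewrite addr_ge0// weighted_kernel_ge0. Qed.

Let measurable_dist_kernel x x' : measurable_fun setT (dist_kernel x x').
Proof. by apply: measurable_funD; exact: measurable_weighted_kernel. Qed.

Lemma conv_kernel_dist_le x x' z : `|H x z - H x' z| <= `|x - x'| * dist_kernel x x' z.
Proof.
rewrite /H /dist_kernel !patchE; case: ifP => _; last by rewrite subrr normr0 addr0 mulr0.
rewrite /conv_kernel /weighted_kernel indicE; case: (_ \in _); last first.
  by rewrite !mul0r subrr normr0 addr0 mulr0.
rewrite !mul1r; have := heat_kernel_dist_le (eps * (t - z.1)) (x - z.2) (x' - z.2).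
rewrite (_ : x - z.2 - (x' - z.2) = x - x'); last by ring.
rewrite (mulrA 2 eps) => /le_trans; apply.
rewrite /g le_eqVlt; apply/orP; left; apply/eqP; ring.
Qed.

(** A bound on the integral of [dist_kernel], which consists of two kernels weighted
    by [g]; adding 1 makes it positive even if the bound is 0. *)
Definition drift_mass : R := 2 * (gaussk_lip * (excess (eps * t) 0 / eps)) + 1.

Lemma excess0_ge0 : 0 <= excess (eps * t) 0 / eps.
Proof.
rewrite -lee_fin; have := integral_gaussk_time 0 eps0 t0.
rewrite maxxx subr0 => <-; apply: integral_ge0 => s _.
by rewrite lee_fin gaussk_ge0.
Qed.

Lemma drift_mass_gt0 : 0 < drift_mass.
Proof.
rewrite /drift_mass ltr_wpDl// mulr_ge0// mulr_ge0 ?gaussk_lip_ge0//.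
exact: excess0_ge0.
Qed.

Lemma integral_dist_kernel x x' : (\int[lam]_z (dist_kernel x x' z)%:E <= drift_mass%:E)%E.
Proof.
have G1 x0 : (\int[lam]_z ((weighted_kernel g (2 * eps) x0 \_ (spacetime T)) z)%:E <=
    (gaussk_lip * (excess (eps * t) 0 / eps))%:E)%E.
  apply: le_trans (integral_weighted_kernel _ _ mg g0) _; rewrite /g.
  under eq_integral do rewrite EFinM.
  rewrite ge0_integralZl//.
  - by rewrite integral_gaussk_time// maxxx subr0 EFinM.
  - apply/measurable_funTS/measurable_EFinP; apply: measurable_gaussk => //.
    by apply: measurable_funM => //; exact: measurable_funB.
  - by move=> s _; rewrite lee_fin gaussk_ge0.
  - by rewrite lee_fin gaussk_lip_ge0.
rewrite /dist_kernel; under eq_integral do rewrite EFinD.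
rewrite ge0_integralD//.
- apply: (le_trans (leeD (G1 x) (G1 x'))).
  by rewrite -EFinD lee_fin /drift_mass; move: (gaussk_lip * _) => c; lra.
- by move=> z _; rewrite lee_fin weighted_kernel_ge0.
- by apply/measurable_EFinP; exact: measurable_weighted_kernel.
- by move=> z _; rewrite lee_fin weighted_kernel_ge0.
- by apply/measurable_EFinP; exact: measurable_weighted_kernel.
Qed.

Lemma integral_conv_kernel x : (\int[lam]_z (H x z)%:E <= t%:E)%E.
Proof.
rewrite conv_kernelE; apply: le_trans (integral_weighted_kernel _ _ _ _) _ => //.
have tE : mu `[0%R, t]%classic = t%:E.
  by rewrite lebesgue_measure_itv/= lte_fin t0 oppr0 adde0.
by rewrite (eq_integral (cst 1%E))// integral_cst// mul1e -tE lexx.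
Qed.

Let abs_reaction : (R * R) * Omega -> R := fun zw => `|reaction zw|.

Let measurable_abs_reaction : measurable_fun setT abs_reaction.
Proof. by apply: measurableT_comp => //; exact: measurable_reaction. Qed.

(** The integral of the absolute value is a random variable with finite second
    moment, hence almost surely finite. *)
Lemma ae_integrable_drift x :
  {ae P, forall w, lam.-integrable setT (fun z => (H x z * reaction (z, w))%:E)}.
Proof.
have [K K0 hK] := reaction_moment.
have H0 z : 0 <= H x z by rewrite conv_kernelE weighted_kernel_ge0.
have [mY EY] := @second_moment_integral R _ Omega P _
  (measurableTypeR R * measurableTypeR R)%type
  lebesgue2_sf (H x) abs_reaction t K
  (measurable_conv_kernel x) H0 measurable_abs_reaction (fun zw => normr_ge0 _) t0
  (integral_conv_kernel x) hK.
set Y := (fun w => _) in mY EY.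
have Y0 w : (0 <= Y w)%E.
  by apply: integral_ge0 => z _; rewrite lee_fin mulr_ge0// normr_ge0.
have iY : P.-integrable setT (fun w => (Y w * Y w)%E).
  apply/integrableP; split; first exact: emeasurable_funM.
  under eq_integral do rewrite gee0_abs ?mule_ge0//.
  by apply: le_lt_trans EY _; rewrite ltry.
have := integrable_ae measurableT iY; apply: filterS => w /(_ I) YY.
apply/integrableP; split.
  apply/measurable_EFinP; apply: measurable_funM; first exact: measurable_conv_kernel.
  exact: measurable_reaction_section.
under eq_integral do rewrite /= normrM (ger0_norm (H0 _)).
rewrite -/(Y w); move: YY (Y0 w); case: (Y w) => [r||]//= _ _; exact: ltry.
Qed.

(** The increment is at most |x - x'| times the integral of [dist_kernel] against
    the absolute reaction term, whose second moment [second_moment_integral]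
    bounds. X is a measurable version of the increment. *)
Lemma drift_increment : exists2 C : R, 0 <= C & forall x x' (X : Omega -> R),
  measurable_fun setT X ->
  {ae P, forall w, X w = drift x w - drift x' w} ->
  (\int[P]_w (X w ^+ 2)%:E <= (C * (x - x') ^+ 2)%:E)%E.
Proof.
have [K K0 hK] := reaction_moment.
exists (drift_mass ^+ 2 * K); first by rewrite mulr_ge0// sqr_ge0.
move=> x x' X mX XE.
have [mY EY] := @second_moment_integral R _ Omega P _
  (measurableTypeR R * measurableTypeR R)%type
  lebesgue2_sf (dist_kernel x x') abs_reaction drift_mass K
  (measurable_dist_kernel x x') (dist_kernel_ge0 x x') measurable_abs_reaction (fun zw => normr_ge0 _)
  drift_mass_gt0
  (integral_dist_kernel x x') hK.
set Y := (fun w => _) in mY EY.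
have Y0 w : (0 <= Y w)%E.
  by apply: integral_ge0 => z _; rewrite lee_fin mulr_ge0// normr_ge0.
have mH x0 w : measurable_fun setT (fun z => H x0 z * reaction (z, w)).
  by apply: measurable_funM; [exact: measurable_conv_kernel|exact: measurable_reaction_section].
have XY : {ae P, forall w, setT w ->
    ((X w ^+ 2)%:E <= ((x - x') ^+ 2)%:E * (Y w * Y w))%E}.
  apply: filterS3 XE (ae_integrable_drift x) (ae_integrable_drift x').
  move=> w XE i1 i2 _.
  have XwY : (`|X w|%:E <= `|x - x'|%:E * Y w)%E.
    rewrite XE driftE// driftE// -RintegralB//.
    apply: (@le_trans _ _ (\int[lam]_z `|(H x z * reaction (z, w) - H x' z * reaction (z, w))%:E|)%E).
      rewrite EFin_normr_Rintegral//; last exact: (integrableB measurableT i1 i2).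
      apply: le_abse_integral => //.
      by apply/measurable_EFinP; apply: measurable_funB; exact: mH.
    rewrite -ge0_integralZl//.
    - apply: ge0_le_integral => //.
      + apply: measurableT_comp => //.
        by apply/measurable_EFinP; apply: measurable_funB; exact: mH.
      + apply: measurable_funeM; apply/measurable_EFinP; apply: measurable_funM.
          exact: measurable_dist_kernel.
        exact: measurable_fun_pair1.
      + move=> z _; rewrite -EFinM /= lee_fin -mulrBl normrM mulrA.
        by rewrite ler_wpM2r// conv_kernel_dist_le.
    - apply/measurable_EFinP; apply: measurable_funM; first exact: measurable_dist_kernel.
      exact: measurable_fun_pair1.
    - by move=> z _; rewrite lee_fin mulr_ge0// normr_ge0.
  have -> : ((X w ^+ 2)%:E = `|X w|%:E * `|X w|%:E)%E.
    by rewrite -EFinM -expr2 real_normK ?num_real.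
  have -> : (((x - x') ^+ 2)%:E = `|x - x'|%:E * `|x - x'|%:E)%E.
    by rewrite -EFinM -expr2 real_normK ?num_real.
  by rewrite muleACA lee_pmul// lee_fin.
apply: (@le_trans _ _ (\int[P]_w (((x - x') ^+ 2)%:E * (Y w * Y w)))%E).
  apply: ae_ge0_le_integral => //.
  - by move=> w _; rewrite lee_fin sqr_ge0.
  - by apply/measurable_EFinP; exact: measurable_funX.
  - by move=> w _; rewrite !mule_ge0// lee_fin sqr_ge0.
  - by apply: measurable_funeM; exact: emeasurable_funM.
rewrite ge0_integralZl//.
- by rewrite (mulrC _ ((x - x') ^+ 2)) (EFinM ((x - x') ^+ 2)) lee_wpmul2l// lee_fin sqr_ge0.
- exact: emeasurable_funM.
- by move=> w _; rewrite mule_ge0.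
- by rewrite lee_fin sqr_ge0.
Qed.

End drift_term.

(** * The quadratic variation of the solution *)

Section spatial_quadratic_variation.
Context {R : realType}.

Lemma cvg0_of_tradeoff (a h : nat -> R) (al be ga : R) :
  0 <= al -> 0 <= be -> 0 <= ga ->
  (forall n, 0 <= a n) -> (forall n, 0 <= h n) -> h n @[n --> \oo] --> (0:R) ->
  (forall n eta, 0 < eta -> eta <= 1 -> a n <= eta * al + h n * (be / eta + ga)) ->
  a n @[n --> \oo] --> (0:R).
Proof.
move=> al0 be0 ga0 a0 h0 hl H; apply/cvgrPdist_le => e e0.
(* The first term is at most e / 2, whatever n is. *)
pose eta := Num.min 1 (e / (2 * (al + 1))).
have al1 : 0 < 2 * (al + 1) by rewrite mulr_gt0// ltr_wpDl.
have eta0 : 0 < eta by rewrite lt_min ltr01 divr_gt0.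
have eta1 : eta <= 1 by rewrite ge_min lexx.
have etae : eta * al <= e / 2.
  apply: (@le_trans _ _ (e / (2 * (al + 1)) * al)).
    by rewrite ler_wpM2r// ge_min lexx orbT.
  rewrite -mulrA ler_wpM2l ?(ltW e0)// mulrC ler_pdivrMr//; lra.
pose c := be / eta + ga + 1.
have c0 : 0 < c by rewrite ltr_wpDl// addr_ge0// divr_ge0// ltW.
near=> n; rewrite distrC subr0 ger0_norm//.
apply: le_trans (H n eta eta0 eta1) _.
rewrite [e]splitr lerD//.
have hn : h n <= e / 2 / c.
  by near: n; apply: (cvgr_le 0) hl _ _; rewrite !divr_gt0.
apply: (@le_trans _ _ (h n * c)); first by rewrite ler_wpM2l// /c lerDl.
by rewrite -ler_pdivlMr.
Unshelve. all: by end_near. Qed.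

Section solution.
Context d (Omega : measurableType d) (P : probability Omega R).
Variables (T : R) (W : set (R * R) -> Omega -> R).
Hypothesis hW : white_noise P T W.
Variables (eps t : R).
Hypotheses (eps0 : 0 < eps) (t0 : 0 < t) (tT : t <= T).
Notation lam := (@lebesgue2 R).
Notation H x := (conv_kernel eps t x \_ (spacetime T)).

(** The bilinear expansion of the increments is minus the second difference of the
    covariance at x - x'. *)
Lemma ip_conv_kernel_increment (x x' h : R) (sH : forall y, y \in [:: x; x + h; x'; x' + h] ->
    sqint lam (H y)) : 0 <= h <= 1 -> x = x' \/ h <= `|x - x'| <= 1 - h ->
  exists2 D : R, 0 <= D <= 2 * gaussk_cst (2 * eps * t) * h ^+ 2 &
    ip lam (fun z => H (x + h) z - H x z) (fun z => H (x' + h) z - H x' z) =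
    ((if x == x' then h else 0) - D) / (2 * eps).
Proof.
move=> h01 hx.
have s1 : sqint lam (H x) by apply: sH; rewrite !inE eqxx.
have s2 : sqint lam (H (x + h)) by apply: sH; rewrite !inE eqxx orbT.
have s3 : sqint lam (H x') by apply: sH; rewrite !inE eqxx !orbT.
have s4 : sqint lam (H (x' + h)) by apply: sH; rewrite !inE eqxx !orbT.
have a0 : 0 < 2 * eps by rewrite mulr_gt0.
have E y y' : sqint lam (H y) -> sqint lam (H y') ->
    heat_cov (2 * eps) t (y - y') = (ip lam (H y) (H y'))%:E.
  by move=> sy sy'; rewrite (ip_conv_kernel eps0 t0 tT sy sy').
have e1 := E _ _ s1 s3; have e2 := E _ _ s2 s3; have e3 := E _ _ s1 s4.
have e4 := E _ _ s2 s4.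
have z1 : x + h - (x' + h) = x - x' by ring.
have z2 : x + h - x' = x - x' + h by ring.
have z3 : x - (x' + h) = x - x' - h by ring.
rewrite z1 in e4; rewrite z2 in e2; rewrite z3 in e3.
have hz : x - x' = 0 \/ h <= `|x - x'| <= 1 - h.
  by case: hx => [->|]; [left; rewrite subrr|right].
have [D hD DE] := @heat_cov_diff2 R (2 * eps) t (x - x') h a0 t0 h01 hz
  ltac:(by rewrite e1) ltac:(by rewrite e2) ltac:(by rewrite e3).
exists D => //; move: DE; rewrite subr_eq0 => <-.
have f4 := EFin_inj (etrans (esym e4) e1).
rewrite (ipB s2 s1 s4 s3) f4 e1 e2 e3.
by move: (ip _ _ _) (ip _ _ _) (ip _ _ _) => a b c /=; ring.
Qed.

(** Replacing D by E inside the sum of squares costs a small multiple of the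
    quadratic variation of E plus a large multiple of that of D - E, by
    |x^2 - y^2| <= eta y^2 + (1 + 1 / eta) (x - y)^2. *)
Lemma qv_perturbation (r : seq nat) (D E : nat -> Omega -> R) (c eta B : R) :
  0 < eta -> (forall i, sqint P (D i)) -> (forall i, sqint P (E i)) ->
  (forall i, i \in r -> ip P (fun w => D i w - E i w) (fun w => D i w - E i w) <= B) ->
  \int[P]_w `|\sum_(i <- r) D i w ^+ 2 - c| <=
  \int[P]_w `|\sum_(i <- r) E i w ^+ 2 - c| + eta * \sum_(i <- r) ip P (E i) (E i) +
    (1 + eta^-1) * ((size r)%:R * B).
Proof.
move=> e0 sD sE hB.
have sF i : sqint P (fun w => D i w - E i w) := sqintB (sD i) (sE i).
have ic := finite_measure_integrable_cst P c measurableT.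
have [iD _] := Rintegral_sumr r (fun i => (sD i).2).
have [iE eE] := Rintegral_sumr r (fun i => (sE i).2).
have [iF eF] := Rintegral_sumr r (fun i => (sF i).2).
have iDc := integrable_norm (integrableB measurableT iD ic).
have iEc := integrable_norm (integrableB measurableT iE ic).
have iE' := integrableZl measurableT eta iE.
have iF' := integrableZl measurableT (1 + eta^-1) iF.
apply: (@le_trans _ _ (\int[P]_w (`|\sum_(i <- r) E i w ^+ 2 - c| +
   eta * (\sum_(i <- r) E i w ^+ 2) +
   (1 + eta^-1) * (\sum_(i <- r) (D i w - E i w) ^+ 2)))).
  apply: le_Rintegral => //.
    exact: (integrableD measurableT (integrableD measurableT iEc iE') iF').
  move=> w _.
  have step i : `|D i w ^+ 2 - E i w ^+ 2| <=
      eta * E i w ^+ 2 + (1 + eta^-1) * (D i w - E i w) ^+ 2.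
    move: (D i w) (E i w) => x y.
    have q : 0 <= eta^-1 * (eta * y - (x - y)) ^+ 2.
      by rewrite mulr_ge0 ?sqr_ge0// invr_ge0 ltW.
    have q' : 0 <= eta^-1 * (eta * y + (x - y)) ^+ 2.
      by rewrite mulr_ge0 ?sqr_ge0// invr_ge0 ltW.
    have id1 : eta^-1 * (eta * y - (x - y)) ^+ 2 =
      eta * y ^+ 2 - 2 * y * (x - y) + eta^-1 * (x - y) ^+ 2.
      by field; exact: lt0r_neq0.
    have id2 : eta^-1 * (eta * y + (x - y)) ^+ 2 =
      eta * y ^+ 2 + 2 * y * (x - y) + eta^-1 * (x - y) ^+ 2.
      by field; exact: lt0r_neq0.
    have id3 : x ^+ 2 - y ^+ 2 = 2 * y * (x - y) + (x - y) ^+ 2 by ring.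
    have s0 := sqr_ge0 (x - y).
    rewrite ler_norml id3; apply/andP; split; lra.
  rewrite (_ : _ - c = (\sum_(i <- r) E i w ^+ 2 - c) +
      \sum_(i <- r) (D i w ^+ 2 - E i w ^+ 2)); last by rewrite sumrB; ring.
  apply: le_trans (ler_normD _ _) _; rewrite -addrA lerD2l.
  apply: le_trans (ler_norm_sum _ _ _) _.
  by rewrite !mulr_sumr -big_split/=; apply: ler_sum => i _; exact: step.
rewrite RintegralD//; last exact: (integrableD measurableT iEc iE').
rewrite RintegralD// !RintegralZl// eE eF.
rewrite -!addrA lerD2l; apply: lerD.
  by rewrite ler_pM2l//; apply: ler_sum => i _; rewrite ip_sq.
rewrite ler_wpM2l ?addr_ge0 ?invr_ge0 ?(ltW e0)//.
apply: (@le_trans _ _ (\sum_(i <- r) B)).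
  rewrite big_seq [leRHS]big_seq; apply: ler_sum => i ir.
  by rewrite -ip_sq; exact: hB.
by rewrite big_const_seq count_predT iter_addr_0 mulr_natl.
Qed.

Variables (A1 A2 : R).
Hypotheses (hA : A1 < A2) (hAT : `[A1, A2]%classic `<=` `[0, 1[%classic).
Variable u : R -> R -> Omega -> R.
Hypotheses (hu : mild_solution P T eps W u) (hmom : bounded_moments P T u).

Let L := A2 - A1.
Let c := 2^-1 * L * eps^-1.
Let grid N i : R := A1 + i%:R * (L / N%:R).

Lemma mesh_bounds : 0 < L <= 1.
Proof.
have m1 : `[A1, A2]%classic A1 by rewrite /= in_itv/= lexx ltW.
have m2 : `[A1, A2]%classic A2 by rewrite /= in_itv/= lexx ltW.
move/hAT: m1; move/hAT: m2; rewrite /= !in_itv/= /L => /andP[_ A2lt1] /andP[A1ge0 _].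
by apply/andP; split; [rewrite subr_gt0|apply: ltW; lra].
Qed.

Lemma grid_in N i : (0 < N)%N -> (i <= N)%N -> `[0, 1[%classic (grid N i).
Proof.
move=> N0 iN; apply: hAT; rewrite /= in_itv/= /grid.
have /andP[L0 _] := mesh_bounds.
rewrite lerDl mulr_ge0 ?divr_ge0 ?(ltW L0)//=.
rewrite -lerBrDl -/L mulrA ler_pdivrMr ?ltr0n// mulrC ler_pM2l//.
by rewrite ler_nat.
Qed.

Lemma spacetime_t y : `[0, 1[%classic y -> spacetime T (t, y).
Proof. by move=> hy; split => //=; rewrite in_itv/= (ltW t0) tT. Qed.

Lemma sqint_u y : `[0, 1[%classic y -> sqint P (u t y).
Proof.
move=> hy; have hy' := spacetime_t hy.
have mz : measurable_fun setT (u t y) := measurable_u hu.1 hy'.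
split => //; have [S S0 hS] := moment_bound t0 tT hmom (isT : (1 < 2)%N).
apply/integrableP; split; first by apply/measurable_EFinP; exact: measurable_funX.
apply: le_lt_trans (ltry S); apply: le_trans (hS _ hy').
rewrite le_eqVlt; apply/orP; left; apply/eqP.
by apply: eq_integral => w _ /=; rewrite normrX.
Qed.

Lemma integrable_spatial_qv N :
  P.-integrable setT (EFin \o spatial_qv A1 A2 N t u).
Proof.
case: N => [|N].
  apply: eq_integrable (integrable0 _ _) => // w _ /=.
  by rewrite /spatial_qv big_geq.
pose y i := grid N.+1 (minn i N.+1).
have su i : sqint P (u t (y i)) by apply/sqint_u/grid_in => //; rewrite geq_minr.
have [iS _] := Rintegral_sumr (index_iota 0 N.+1) (fun i => (sqintB (su i.+1) (su i)).2).
apply: eq_integrable iS => // w _ /=; congr (_%:E).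
apply: eq_big_nat => i /= iN.
by rewrite /y /grid (minn_idPl iN) (minn_idPl (ltnW iN)).
Qed.

(** [qv_perturbation] removes the drift, [wiener_qv_bound] estimates the remaining
    Gaussian quadratic variation, and [increment_cov_sums] evaluates the sums of
    covariances in that estimate. *)
Lemma qv_bound : exists al be ga : R, [/\ 0 <= al, 0 <= be, 0 <= ga &
  forall N eta, 0 < eta -> eta <= 1 ->
    \int[P]_w `|spatial_qv A1 A2 N.+1 t u w - c| <=
    eta * al + L / N.+1%:R * (be / eta + ga)].
Proof.
have /andP[L0 L1] := mesh_bounds.
have [CR CR0 hCR] := drift_increment eps0 t0 tT hu.1 hmom.
have a0 : 0 < 2 * eps by rewrite mulr_gt0.
pose C1 := 2 * gaussk_cst (2 * eps * t).
have C10 : 0 <= C1 by rewrite mulr_ge0// gaussk_cst_ge0.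
pose M := 2 * (1 + C1 ^+ 2) / (2 * eps) ^+ 2.
have M0 : 0 <= M by rewrite divr_ge0 ?sqr_ge0// mulr_ge0// addr_ge0 ?sqr_ge0.
have q0 : 0 <= C1 / (2 * eps) by rewrite divr_ge0// ltW.
have c0 : 0 <= c by rewrite !mulr_ge0 ?invr_ge0 ?(ltW L0) ?(ltW eps0).
exists (2^-1 + c + C1 / (2 * eps)), ((2 * M + (C1 / (2 * eps)) ^+ 2) / 2 + CR), CR.
split => //.
- by rewrite !addr_ge0.
- by rewrite addr_ge0// divr_ge0// addr_ge0 ?sqr_ge0// mulr_ge0.
move=> N' eta e0 e1; set N := N'.+1; pose h := L / N%:R.
have Npos : 0 < N%:R :> R by rewrite ltr0n.
have h0 : 0 < h by rewrite divr_gt0.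
have NhL : N%:R * h = L by rewrite /h mulrC divfK// gt_eqF.
have h1 : h <= 1.
  by apply: le_trans L1; rewrite -NhL ler_peMl ?(ltW h0)// ler1n.
(* The mild formulation gives a Wiener integral for each point separately. *)
have choiceZ y : exists Z : Omega -> R, `[0, 1[%classic y ->
    wiener_integral P T W (conv_kernel eps t y) Z /\
    {ae P, forall w, u t y w = drift eps t u y w + Z w}.
  have [hy|hy] := pselect (`[0, 1[%classic y); last by exists (fun=> 0).
  by have [Z w1 w2] := hu.2 _ _ (spacetime_t hy); exists Z.
have [Zf hZf] := choice choiceZ.
(* The truncation of the index puts every y i in [A1, A2], so that Z i is an actual
   Wiener integral for all i. *)
pose y i := grid N (minn i N).
have yin i : `[0, 1[%classic (y i) by apply: grid_in => //; rewrite geq_minr.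
pose Z i := Zf (y i).
have hZ i : wiener_integral P T W (conv_kernel eps t (y i)) (Z i) := (hZf _ (yin i)).1.
have sH i : sqint lam (H (y i)).
  by have [] := wiener_isometry hW (hZ i) (hZ i).
have sZ i : sqint P (Z i) by have [] := wiener_isometry hW (hZ i) (hZ i).
have su i : sqint P (u t (y i)) := sqint_u (yin i).
have yE i : (i <= N)%N -> y i = A1 + i%:R * h by move=> iN; rewrite /y (minn_idPl iN).
have yS i : (i < N)%N -> y i.+1 = y i + h.
  by move=> iN; rewrite !yE// 1?ltnW// -natr1; ring.
pose kap i j := ip lam (fun z => H (y i.+1) z - H (y i) z)
   (fun z => H (y j.+1) z - H (y j) z).
have kapE i j : (i < N)%N -> (j < N)%N -> exists2 D, 0 <= D <= C1 * h ^+ 2 &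
    kap i j = ((if i == j then h else 0) - D) / (2 * eps).
  move=> iN jN.
  have yij : y i - y j = (i%:R - j%:R) * h.
    by rewrite !yE 1?ltnW//; ring.
  have nij : i != j -> 1 <= `|i%:R - j%:R : R| <= N%:R - 1.
    have -> : N%:R - 1 = N'%:R :> R by rewrite /N -natr1 addrK.
    case: (ltngtP i j) => // [lt|lt] _; [rewrite distrC|];
      rewrite -natrB ?(ltnW lt)// ger0_norm// ler1n subn_gt0 lt ler_nat/=;
      by apply: leq_trans (leq_subr _ _) _.
  have [|||D hD DE] := @ip_conv_kernel_increment (y i) (y j) h _ _ _.
  - by move=> v; rewrite !inE -!yS// => /or4P[] /eqP ->; exact: sH.
  - by rewrite (ltW h0) h1.
  - have [->|ij] := eqVneq i j; [by left|right].
    have /andP[n1 n2] := nij ij.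
    rewrite yij normrM [X in _ * X]ger0_norm ?(ltW h0)// ler_peMl ?(ltW h0)//=.
    by move: n2 => /(ler_wpM2r (ltW h0)) /le_trans; apply; rewrite mulrBl mul1r NhL lerD2r.
  - exists D => //; rewrite /kap !yS// DE; congr ((_ - _) / _).
    congr (if _ then _ else _).
    have [->|ij] := eqVneq i j; first by rewrite eqxx.
    have /andP[n1 _] := nij ij.
    apply/negbTE; rewrite -subr_eq0 yij; apply: mulf_neq0; last by rewrite gt_eqF.
    by apply: contraTneq n1 => ->; rewrite normr0 -ltNge ltr01.
have h01 : 0 <= h <= 1 by rewrite (ltW h0).
have [ks1 ks2] := increment_cov_sums h01 NhL L1 a0 C10 kapE.
have qvE w : spatial_qv A1 A2 N t u w =
    \sum_(i <- index_iota 0 N) (u t (y i.+1) w - u t (y i) w) ^+ 2.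
  rewrite /spatial_qv; apply: eq_big_nat => i /= iN.
  by rewrite !yE// ltnW.
under eq_Rintegral do rewrite qvE.
have pert := @qv_perturbation (index_iota 0 N)
  (fun i w => u t (y i.+1) w - u t (y i) w) (fun i w => Z i.+1 w - Z i w) c eta
  (CR * h ^+ 2) e0 (fun i => sqintB (su i.+1) (su i)) (fun i => sqintB (sZ i.+1) (sZ i)).
apply: le_trans (pert _) _.
  move=> i; rewrite mem_index_iota => /= iN.
  set X := (fun w => _); have sX : sqint P X.
    exact: sqintB (sqintB (su _) (su _)) (sqintB (sZ _) (sZ _)).
  have := hCR (y i.+1) (y i) X sX.1.
  rewrite [y i.+1 - y i](_ : _ = h); last by rewrite yS// addrAC subrr add0r.
  have iX : (\int[P]_w (X w ^+ 2)%:E)%E \is a fin_num.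
    by apply: integrable_fin_num => //; exact: sX.2.
  move=> hX; rewrite ip_sq /Rintegral -lee_fin fineK//; apply: hX.
  apply: filterS2 (hZf _ (yin i)).2 (hZf _ (yin i.+1)).2 => w e1w e2w.
  rewrite /X e1w e2w /Z.
  move: (drift _ _ _ (y i) w) (drift _ _ _ (y i.+1) w) (Zf (y i) w) (Zf (y i.+1) w).
  by move=> *; ring.
have wq := @wiener_qv_bound _ _ _ P T W hW (fun i => conv_kernel eps t (y i)) Z hZ
  (index_iota 0 N) c eta e0.
rewrite /= -/(kap _ _) in wq.
have isoE i : ip P (fun w => Z i.+1 w - Z i w) (fun w => Z i.+1 w - Z i w) = kap i i.
  exact: (@increments_isometry _ _ _ P T W hW (fun i => conv_kernel eps t (y i)) Z hZ i i).
rewrite (eq_bigr (fun i => kap i i)); last by move=> i _; exact: isoE.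
have cE : c = L / (2 * eps).
  by rewrite /c; field; exact: lt0r_neq0.
rewrite cE in wq *.
move: ks1 ks2 wq; rewrite -/M size_iota subn0.
set S := \sum_(0 <= i < N) kap i i; set Q := \sum_(0 <= i < N) \sum_(0 <= j < N) _.
set I := \int[P]_w _; rewrite mulrAC.
move: (L / (2 * eps)) (C1 / (2 * eps)) q0 => c' q q0 ks1 ks2 wq.
have hh : h ^+ 2 <= h by rewrite expr2 ler_piMl// ltW.
have Sc : S <= c' + q * h by move: ks1; rewrite ler_norml => /andP[_]; lra.
have Sc2 : (S - c') ^+ 2 <= q ^+ 2 * h.
  rewrite -(real_normK (num_real _)).
  apply: (@le_trans _ _ ((q * h) ^+ 2)); first by rewrite lerXn2r// nnegrE mulr_ge0// ltW.
  by rewrite exprMn ler_wpM2l// sqr_ge0.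
have QM : Q <= M * h by apply: le_trans ks2 _; rewrite /M mulrAC.
have ei0 : 0 < eta^-1 by rewrite invr_gt0.
have I1 : I <= 2^-1 * eta + (2 * M + q ^+ 2) / 2 * h * eta^-1.
  rewrite -(@ler_pM2l _ (2 * eta)) ?mulr_gt0//.
  apply: le_trans wq _.
  rewrite (_ : 2 * eta * _ = eta ^+ 2 + (2 * M * h + q ^+ 2 * h)).
    by rewrite lerD2l lerD// -mulrA ler_pM2l.
  by field; exact: lt0r_neq0.
have I2 : eta * S <= eta * (c' + q).
  rewrite ler_pM2l//; apply: le_trans Sc _; rewrite lerD2l ler_piMr//.
have I3 : (1 + eta^-1) * (N%:R * (CR * h ^+ 2)) <= (1 + eta^-1) * (CR * h).
  rewrite ler_wpM2l ?addr_ge0 ?(ltW ei0)//.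
  rewrite (_ : _ * _ = CR * (N%:R * h * h)); last by ring.
  by rewrite NhL ler_wpM2l// ler_piMl// ltW.
rewrite -/h.
apply: le_trans (lerD (lerD I1 I2) I3) _.
rewrite le_eqVlt; apply/orP; left; apply/eqP; ring.
Qed.

Lemma cvg_spatial_qv :
  \int[P]_w `|spatial_qv A1 A2 N t u w - c| @[N --> \oo] --> (0:R).
Proof.
have [al [be [ga [al0 be0 ga0 H]]]] := qv_bound.
have /andP[L0 _] := mesh_bounds.
rewrite -cvg_shiftS; apply: (cvg0_of_tradeoff al0 be0 ga0 _ _ _ H).
- by move=> n; apply: Rintegral_ge0 => w _.
- by move=> n; rewrite divr_ge0// ltW.
- rewrite -(mulr0 L); apply: cvgM; first exact: cvg_cst.
  exact: cvg_harmonic.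
Qed.

End solution.
End spatial_quadratic_variation.

Theorem proposition4p3 (R : realType) (d : measure_display)
  (Omega : measurableType d) (P : probability Omega R)
  (T : R) (hT : 0 < T)
  (W : set (R * R) -> Omega -> R) (hW : white_noise P T W)
  (A1 A2 : R) (hA : A1 < A2) (hAT : `[A1, A2]%classic `<=` `[0, 1[%classic)
  (eps : R) (heps : 0 < eps)
  (u : R -> R -> Omega -> R)
  (hu : mild_solution P T eps W u) (hmom : bounded_moments P T u)
  (t : R) (ht0 : 0 < t) (htT : t <= T) :
  cvgLp P 1 (fun N => spatial_qv A1 A2 N t u)
    (fun _ => 2^-1 * (A2 - A1) * eps^-1).
Proof.
have iS := integrable_spatial_qv ht0 htT hA hAT hu hmom.
have ic := finite_measure_integrable_cst P (2^-1 * (A2 - A1) * eps^-1) measurableT.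
split.
- by move=> N; apply/Lfun1_integrable; exact: iS.
- exact/Lfun1_integrable.
have cv := cvg_spatial_qv hW heps ht0 htT hA hAT hu hmom.
have -> : (fun N => 'N[P]_1[EFin \o (spatial_qv A1 A2 N t u \-
    (fun=> 2^-1 * (A2 - A1) * eps^-1))%R])%E =
  (fun N => (\int[P]_w `|spatial_qv A1 A2 N t u w - 2^-1 * (A2 - A1) * eps^-1|)%:E).
  apply/funext => N; rewrite Lnorm1 /Rintegral fineK//.
  apply: integrable_fin_num => //; apply: integrable_norm.
  exact: (integrableB measurableT (iS N) ic).
by apply: cvg_EFin => //; exact: nearW.
Qed.
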